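(* Let $D=(V(D),E(D),w)$ be a weighted oriented graph with underlying simple graph $G$ such that every vertex of $V^{+}=\{x\in V(D): w(x)>1\}$ is a sink. Then the following are equivalent: (1) $I(D)$ is componentwise linear; (2) $I(D)$ is vertex splittable; (3) $I(D)$ has the linear quotient property; (4) $G^c$ is chordal and $|\mathcal{N}_D(x)\cap V^{+}|\leq 1$ for all $x\in V(D)$.
   Context: A weighted oriented graph $D=(V(D),E(D),w)$ consists of a finite vertex set $V(D)=\{x_1,\dots,x_n\}$, a set $E(D)$ of directed edges $(x,y)$ (from $x$ towards $y$) between distinct vertices, obtained by orienting each edge of a simple graph in exactly one direction, and a weight function $w:V(D)\to\{1,2,3,\dots\}$. Its underlying simple graph $G$ has $V(G)=V(D)$ and $E(G)=\{\{x,y\}: (x,y)\in E(D)\text{ or }(y,x)\in E(D)\}$. Identifying vertices with variables of $R=\mathbb{K}[x_1,\dots,x_n]$, $\mathbb{K}$ a field, the edge ideal is $I(D)=(x_ix_j^{w(x_j)} : (x_i,x_j)\in E(D))\subseteq R$. If a vertex is a source (has no incoming edge), its weight does not affect $I(D)$ and by convention is taken to be $1$. A vertex $x$ is a sink if there is no edge $(x,y)\in E(D)$. $\mathcal{N}_D(x)$ is the set of all vertices adjacent to $x$ in $G$. $G^c$ is the complement graph; a simple graph is chordal if it has no induced cycle of length greater than three. For a homogeneous ideal $I\subseteq R$ and $d\ge 0$, $I_{\langle d\rangle}$ denotes the ideal generated by all homogeneous elements of degree $d$ in $I$. $I$ is componentwise linear if for each $d\geq 0$ the ideal $I_{\langle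 d\rangle}$ has a $d$-linear resolution over $R$, i.e. is zero or satisfies $\operatorname{reg}(I_{\langle d\rangle})=d$ (Castelnuovo–Mumford regularity). For a monomial ideal $I$, $\mathcal{G}(I)$ denotes its minimal set of monomial generators. $I$ has the linear quotient property if there is an ordering $u_1<\cdots<u_m$ of $\mathcal{G}(I)$ such that the colon ideal $((u_1,\dots,u_{i-1}):u_i)$ is generated by a subset of the variables for $i=2,\dots,m$. A monomial ideal $I\subseteq\mathbb{K}[X]$ ($X$ a finite set of variables) is vertex splittable if it can be obtained by the following recursive procedure: (i) if $v$ is a monomial and $I=(v)$, or $I=(0)$, or $I$ is the whole ring, then $I$ is vertex splittable; (ii) if there are a variable $x\in X$ and vertex splittable ideals $I_1,I_2$ of $\mathbb{K}[X\setminus\{x\}]$ such that $I=xI_1+I_2$ (with $I_1, I_2$ viewed through their extensions to $\mathbb{K}[X]$), $I_2\subseteq I_1$, and $\mathcal{G}(I)$ is the disjoint union of $\mathcal{G}(xI_1)$ and $\mathcal{G}(I_2)$, then $I$ is vertex splittable. *)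

(* Defs.v *)
From HB Require Import structures.
From mathcomp Require Import all_boot all_order all_algebra.
From mathcomp Require Export mpoly.

Set Implicit Arguments.
Unset Strict Implicit.
Unset Printing Implicit Defensive.

Import GRing.Theory.
Local Open Scope ring_scope.

(* A source (in particular an isolated vertex) carries weight 1.
   [edge_asym] also excludes loops. *)
Record wograph (n : nat) := WOGraph {
  edge : rel 'I_n;
  weight : 'I_n -> nat;
  edge_asym : forall x y, edge x y -> ~~ edge y x;
  weight_gt0 : forall x, (0 < weight x)%N;
  weight_source : forall x, (forall y, ~~ edge y x) -> weight x = 1%N
}.

Section Graphs.
Variables (n : nat) (D : wograph n).

Definition adj : rel 'I_n := fun x y => edge D x y || edge D y x.
Definition nbhd (x : 'I_n) : {set 'I_n} := [set y | adj x y].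
Definition sink (x : 'I_n) : Prop := forall y, ~~ edge D x y.
Definition Vplus : {set 'I_n} := [set x | (1 < weight D x)%N].

End Graphs.

Definition compl_graph (T : eqType) (e : rel T) : rel T :=
  fun x y => (x != y) && ~~ e x y.

Definition induced_cycle (T : eqType) (e : rel T) (c : seq T) : Prop :=
  ucycle e c /\
  {in c &, forall x y, e x y -> (y == next c x) || (x == next c y)}.

Definition chordal (T : eqType) (e : rel T) : Prop :=
  forall c : seq T, induced_cycle e c -> (size c <= 3)%N.

Section Ideals.
Variables (K : fieldType) (n : nat).

(* Ideals are Prop-valued subsets of the polynomial ring, compared
   extensionally by [ideal_eq]. *)
Definition pset := {mpoly K[n]} -> Prop.

Definition ideal_eq (I J : pset) : Prop := forall f, I f <-> J f.
Definition ideal_sub (I J : pset) : Prop := forall f, I f -> J f.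

Definition ideal_gen (S : pset) : pset := fun f =>
  exists s : seq ({mpoly K[n]} * {mpoly K[n]}),
    (forall cg, cg \in s -> S cg.2) /\ f = \sum_(cg <- s) cg.1 * cg.2.

Definition ideal_zero : pset := fun f => f = 0.
Definition ideal_add (I J : pset) : pset := fun f =>
  exists g h, [/\ I g, J h & f = g + h].
Definition ideal_mulX (x : 'I_n) (I : pset) : pset := fun f =>
  exists2 g, I g & f = 'X_x * g.
Definition ideal_colon (I : pset) (u : {mpoly K[n]}) : pset := fun f =>
  I (f * u).

Definition mon_ideal (s : seq 'X_{1..n}) : pset :=
  ideal_gen (fun f => exists2 m, m \in s & f = 'X_[m]).
Definition var_ideal (A : {set 'I_n}) : pset :=
  ideal_gen (fun f => exists2 x, x \in A & f = 'X_x).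

(* [s] enumerates, without repetition, the minimal set of monomial
   generators of [I]; such an [s] is unique up to permutation. *)
Definition min_mon_gens (I : pset) (s : seq 'X_{1..n}) : Prop :=
  [/\ uniq s,
      ideal_eq I (mon_ideal s)
    & forall t, {subset t <= s} -> ideal_eq I (mon_ideal t) ->
        {subset s <= t}].

Definition linear_quotients (I : pset) : Prop :=
  exists s, min_mon_gens I s /\
    forall i, (0 < i < size s)%N ->
      exists A : {set 'I_n},
        ideal_eq (ideal_colon (mon_ideal (take i s)) 'X_[nth 0%MM s i])
                 (var_ideal A).

(* [vertex_splittable X I]: [I] is the extension to the full polynomial ring
   of a vertex splittable ideal of the polynomial ring on the variables in
   [X].  Equality, inclusion and minimal generators of monomial ideals do not
   change under this extension.  The uniqueness of [s1 ++ s2] contained in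
   [min_mon_gens I (s1 ++ s2)] gives the disjointness of the union. *)
Inductive vertex_splittable : {set 'I_n} -> pset -> Prop :=
| VSmon (X : {set 'I_n}) (I : pset) (v : 'X_{1..n}) :
    (forall i, i \notin X -> v i = 0%N) ->
    ideal_eq I (mon_ideal [:: v]) -> vertex_splittable X I
| VSzero (X : {set 'I_n}) (I : pset) :
    ideal_eq I ideal_zero -> vertex_splittable X I
| VSfull (X : {set 'I_n}) (I : pset) :
    ideal_eq I (fun=> True) -> vertex_splittable X I
| VSsplit (X : {set 'I_n}) (I I1 I2 : pset) (x : 'I_n)
    (s1 s2 : seq 'X_{1..n}) :
    x \in X ->
    vertex_splittable (X :\ x) I1 ->
    vertex_splittable (X :\ x) I2 ->
    ideal_eq I (ideal_add (ideal_mulX x I1) I2) ->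
    ideal_sub I2 I1 ->
    min_mon_gens (ideal_mulX x I1) s1 ->
    min_mon_gens I2 s2 ->
    min_mon_gens I (s1 ++ s2) -> vertex_splittable X I.

(* Graded free resolution  ... -> F_1 -> F_0 -> I -> 0.  The module F_i is
   free with basis indexed by 'I_(res_rank i), the p-th basis element having
   degree [res_deg p]; its elements are row vectors and maps act by right
   multiplication.  Natural shifts suffice: by minimality, no basis element
   has degree below the least degree of an element of I. *)
Record graded_resolution (I : pset) := GradedResolution {
  res_rank : nat -> nat;
  res_deg : forall i, 'I_(res_rank i) -> nat;
  res_aug : 'cV[{mpoly K[n]}]_(res_rank 0);
  res_diff : forall i, 'M[{mpoly K[n]}]_(res_rank i.+1, res_rank i);
  res_aug_homog : forall p, res_aug p 0 \is (res_deg p).-homog;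
  res_diff_homog : forall i p q, res_diff i p q != 0 ->
    (res_deg q <= res_deg p)%N /\
    res_diff i p q \is (res_deg p - res_deg q)%N.-homog;
  res_aug_image : forall f,
    I f <-> exists v : 'rV_(res_rank 0), f = (v *m res_aug) 0 0;
  res_exact0 : forall v : 'rV_(res_rank 0),
    v *m res_aug = 0 <-> exists u, v = u *m res_diff 0;
  res_exactS : forall i (v : 'rV_(res_rank i.+1)),
    v *m res_diff i = 0 <-> exists u, v = u *m res_diff i.+1
}.

(* All entries of the differentials lie in the ideal (x_1, ..., x_n). *)
Definition minimal_resolution (I : pset) (F : graded_resolution I) : Prop :=
  forall i p q, (res_diff F i p q)@_0%MM = 0.

Definition graded_betti (I : pset) (F : graded_resolution I) (i j : nat) :
    nat :=
  #|[set p : 'I_(res_rank F i) | res_deg p == j]|.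

(* reg I = max { j - i | beta_(i,j) != 0 } = d, read off a minimal graded free
   resolution; these exist and are unique up to isomorphism for homogeneous
   ideals. *)
Definition is_regularity (I : pset) (d : nat) : Prop :=
  exists F : graded_resolution I,
    [/\ minimal_resolution F,
        forall i j, graded_betti F i j != 0%N -> (j <= d + i)%N
      & exists i, graded_betti F i (d + i) != 0%N].

Definition has_linear_resolution (d : nat) (I : pset) : Prop :=
  ideal_eq I ideal_zero \/ is_regularity I d.

Definition ideal_deg (d : nat) (I : pset) : pset :=
  ideal_gen (fun f => I f /\ f \is d.-homog).

Definition componentwise_linear (I : pset) : Prop :=
  forall d, has_linear_resolution d (ideal_deg d I).

Definition edge_ideal (D : wograph n) : pset :=
  ideal_gen (fun f => exists x y, edge D x y /\ f = 'X_x * 'X_y ^+ weight D y).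

End Ideals.

Arguments edge_ideal K {n} D _.

(* Main.v *)
Require Import Defs.
From mathcomp Require Import all_boot all_order all_algebra.
From mathcomp Require Import zify ring.

(** The four conditions are linked in a cycle: vertex splittable, linear
    quotients, componentwise linear, the condition on the graph, and back to
    vertex splittable.  The first two arrows hold for all monomial ideals.

    Vertex splittable ideals have linear quotients: for I = x I1 + I2, listing
    the generators of x I1 before those of I2 works, since I2 lies in I1
    ([vertex_splittable_lq]).

    Linear quotients give componentwise linearity.  Each ideal generated by the
    monomials of degree d of I again has linear quotients
    ([lq_order_component]), and adding to an ideal J a generator u of degree d
    with (J : u) generated by variables preserves linearity of the resolution,
    by a mapping cone ([linear_resolution_cone]).  The same cone, applied to one
    variable at a time, resolves the ideals generated by variables.

    Componentwise linearity forces the condition on the graph.  Comparing a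
    resolution of J with the Koszul complex shows that, if J has a d-linear
    resolution, each Koszul cycle with coefficients in J in homological degree s
    and internal degree larger than d + s bounds ([koszul_cycle_boundary]).  An
    induced cycle of length at least 4 in the complement graph, or two
    neighbours of a vertex in V+, yields a cycle violating this for a suitable
    component of the edge ideal; the violation is read off in a single
    multidegree ([linear_koszul], [cycle_potential], [componentwise_nbhd]).

    Finally, let G have an edge.  In a chordal graph every vertex that is not
    adjacent to all others has a simplicial vertex among its non-neighbours
    ([chordal_simplicial]).  As V+ is a clique of the complement of G, this
    yields a simplicial vertex x of the complement of weight 1.  The edge ideal
    splits at x as x N + I', where N is generated by powers of the neighbours of
    x and I' is the edge ideal without x; at most one generator of N is not a
    variable, which makes N vertex splittable
    ([edge_mons_vertex_splittable]). *)

Set Implicit Arguments.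
Unset Strict Implicit.
Unset Printing Implicit Defensive.

Import GRing.Theory.
Local Open Scope ring_scope.

(** * Monomial ideals *)

Section GeneratedIdeals.
Variables (K : fieldType) (n : nat).
Implicit Types (S T : pset K n) (f g : {mpoly K[n]}).

Lemma ideal_eq_refl S : ideal_eq S S. Proof. by []. Qed.

Lemma ideal_eq_sym S T : ideal_eq S T -> ideal_eq T S.
Proof. by move=> e f; split=> /e. Qed.

Lemma ideal_eq_trans S T U : ideal_eq S T -> ideal_eq T U -> ideal_eq S U.
Proof. by move=> e1 e2 f; split=> [/e1/e2|/e2/e1]. Qed.

Lemma ideal_gen0 S : ideal_gen S 0.
Proof. by exists [::]; rewrite big_nil. Qed.

Lemma ideal_genD S f g : ideal_gen S f -> ideal_gen S g -> ideal_gen S (f + g).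
Proof.
move=> [s [hs ->]] [t [ht ->]]; exists (s ++ t); rewrite big_cat; split=> //.
by move=> cg; rewrite mem_cat => /orP[/hs|/ht].
Qed.

Lemma ideal_genM S f g : ideal_gen S g -> ideal_gen S (f * g).
Proof.
move=> [s [hs ->]]; exists [seq (f * cg.1, cg.2) | cg <- s]; split.
  by move=> cg /mapP[cg' /hs h ->].
by rewrite big_map mulr_sumr; apply: eq_bigr => cg _; rewrite mulrA.
Qed.

Lemma ideal_gen_sum S (I : eqType) (r : seq I) (F : I -> {mpoly K[n]}) :
  {in r, forall i, ideal_gen S (F i)} -> ideal_gen S (\sum_(i <- r) F i).
Proof.
move=> h; rewrite big_seq; elim/big_ind: _ => //.
- exact: ideal_gen0.
- by move=> *; apply: ideal_genD.
Qed.

Lemma ideal_gen_id S f : S f -> ideal_gen S f.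
Proof.
move=> Sf; exists [:: (1, f)]; rewrite big_seq1 mul1r; split=> //.
by move=> cg; rewrite inE => /eqP ->.
Qed.

Lemma ideal_gen_min S T :
  (forall f, S f -> ideal_gen T f) -> ideal_sub (ideal_gen S) (ideal_gen T).
Proof.
move=> h f [s [hs ->]]; apply: ideal_gen_sum => cg /hs Sc.
exact/ideal_genM/h.
Qed.

Lemma ideal_gen_ext S T : ideal_eq S T -> ideal_eq (ideal_gen S) (ideal_gen T).
Proof.
by move=> e f; split; apply: ideal_gen_min => g /e h; apply: ideal_gen_id.
Qed.

(** Stated for a possibly infinite family M of monomials, so as to cover lists
    of generators and sets of variables alike. *)
Lemma mon_gen_msupp (M : 'X_{1..n} -> Prop) f :
  ideal_gen (fun g => exists2 m, M m & g = 'X_[m]) f <->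
  (forall m, m \in msupp f -> exists2 u, M u & (u <= m)%MM).
Proof.
split=> [[s [hs ->]] m|h].
  move/msupp_sum_le => /=.
  elim: s hs => //= cg s IH hs; rewrite mem_cat => /orP[|]; last first.
    by apply: IH => cg' h; apply: hs; rewrite inE h orbT.
  have [u uM ->] := hs cg (mem_head _ _).
  move/msuppM_le => /allpairsP[[m1 m2] /= [_]].
  rewrite msuppX inE => /eqP -> ->; exists u => //; exact: lem_addl.
rewrite [f]mpolyE; apply: ideal_gen_sum => m /h[u uM um].
have -> : f@_m *: 'X_[m] = (f@_m *: 'X_[m - u]) * 'X_[u] :> {mpoly K[n]}.
  by rewrite -scalerAl -mpolyXD submK.
by apply/ideal_genM/ideal_gen_id; exists u.
Qed.

Lemma mon_idealP (s : seq 'X_{1..n}) f :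
  mon_ideal s f <->
  (forall m, m \in msupp f -> exists2 u, u \in s & (u <= m)%MM).
Proof. exact: mon_gen_msupp. Qed.

Lemma mon_idealX (s : seq 'X_{1..n}) m :
  mon_ideal s ('X_[m] : {mpoly K[n]}) <-> exists2 u, u \in s & (u <= m)%MM.
Proof.
rewrite mon_idealP; split=> [h|h m']; first by apply: h; rewrite msuppX inE.
by rewrite msuppX inE => /eqP ->.
Qed.

Lemma mon_ideal_eq (s t : seq 'X_{1..n}) :
  (forall u, u \in s -> exists2 v, v \in t & (v <= u)%MM) ->
  (forall u, u \in t -> exists2 v, v \in s & (v <= u)%MM) ->
  ideal_eq (mon_ideal s : pset K n) (mon_ideal t).
Proof.
move=> h1 h2 f; rewrite !mon_idealP; split=> h m /h[u us um].
  by have [v vt vu] := h1 u us; exists v => //; apply: lepm_trans vu um.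
by have [v vt vu] := h2 u us; exists v => //; apply: lepm_trans vu um.
Qed.

Lemma var_idealP (A : {set 'I_n}) f :
  var_ideal A f <->
  (forall m, m \in msupp f -> exists2 x, x \in A & (0 < m x)%N).
Proof.
have -> : var_ideal A f <->
  ideal_gen (fun g => exists2 m, (exists2 x, x \in A & m = U_(x)%MM)
    & g = 'X_[m]) f.
  apply: ideal_gen_ext => g; split.
    by move=> [x xA ->]; exists U_(x)%MM => //; exists x.
  by move=> [m [x xA ->] ->]; exists x.
rewrite mon_gen_msupp; split=> h m /h.
  by move=> [u [x xA ->]]; rewrite lep1mP -lt0n; exists x.
by move=> [x xA mx]; exists U_(x)%MM; [exists x | rewrite lep1mP -lt0n].
Qed.

Lemma mpolyXU_mon (x : 'I_n) m : 'X_x * 'X_[m] = 'X_[U_(x) + m] :> {mpoly K[n]}.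
Proof. by rewrite mpolyXD. Qed.

Lemma msuppXM (u m : 'X_{1..n}) f :
  m \in msupp (f * 'X_[u]) -> exists2 m', m' \in msupp f & m = (m' + u)%MM.
Proof.
by rewrite (perm_mem (msuppMX _ _)) => /mapP[m' h ->]; exists m'; rewrite // addmC.
Qed.

Lemma mem_msuppMX (u m : 'X_{1..n}) f :
  ((m + u)%MM \in msupp (f * 'X_[u])) = (m \in msupp f).
Proof. by rewrite !mcoeff_msupp addmC mcoeffMX. Qed.

Lemma ideal_mulX_mon (x : 'I_n) (s : seq 'X_{1..n}) :
  ideal_eq (ideal_mulX x (mon_ideal s : pset K n))
           (mon_ideal [seq (U_(x) + u)%MM | u <- s]).
Proof.
move=> f; split=> [[g /mon_idealP hg ->]|/mon_idealP h].
  apply/mon_idealP => m; rewrite mulrC => /msuppXM[m' /hg[u us um] ->].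
  exists (U_(x) + u)%MM; first exact: map_f.
  by apply/mnm_lepP => i; rewrite !mnmDE addnC leq_add2r; apply/mnm_lepP.
exists (\sum_(m <- msupp f) f@_m *: 'X_[m - U_(x)]).
  apply/mon_idealP => m /msupp_sum_le /flatten_mapP[m' ].
  rewrite filter_predT => /[dup] m'f /h [_ /mapP[u us ->] um] /msuppZ_le.
  rewrite msuppX inE => /eqP ->; exists u => //.
  apply/mnm_lepP => i; have /mnm_lepP/(_ i) := um; rewrite mnmDE mnmBE; lia.
rewrite mulr_sumr [LHS]mpolyE big_seq [RHS]big_seq; apply: eq_bigr => m.
move=> /h [_ /mapP[u us ->] um].
rewrite -scalerAr mpolyXU_mon addmC submK //; apply: lepm_trans um; exact: lem_addr.
Qed.

Lemma ideal_add_mon (s t : seq 'X_{1..n}) :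
  ideal_eq (ideal_add (mon_ideal s : pset K n) (mon_ideal t))
           (mon_ideal (s ++ t)).
Proof.
move=> f; split.
  move=> [g [h [/mon_idealP hg /mon_idealP hh ->]]]; apply/mon_idealP => m.
  move=> /msuppD_le; rewrite mem_cat => /orP[/hg|/hh] [u us um]; exists u => //;
  by rewrite mem_cat us ?orbT.
move=> [r [hr ->]].
rewrite (bigID (fun cg => has (fun m => cg.2 == 'X_[m]) s)) /=.
set g := (X in X + _); set h := (X in _ + X); exists g, h; split=> //.
  rewrite /g -big_filter; apply: ideal_gen_sum => cg.
  rewrite mem_filter => /andP[/hasP[m ms /eqP ->] _].
  by apply/ideal_genM/ideal_gen_id; exists m.
rewrite /h -big_filter; apply: ideal_gen_sum => cg.
rewrite mem_filter => /andP[/hasPn no /hr[m]]; rewrite mem_cat.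
case/orP=> [/no ne|mt] eq; first by rewrite eq eqxx in ne.
by apply/ideal_genM/ideal_gen_id; exists m.
Qed.

Lemma ideal_mulX_ext x S T :
  ideal_eq S T -> ideal_eq (ideal_mulX x S) (ideal_mulX x T).
Proof. by move=> e f; split=> -[g /e h ->]; exists g. Qed.

Lemma ideal_add_ext S S' T T' : ideal_eq S S' -> ideal_eq T T' ->
  ideal_eq (ideal_add S T) (ideal_add S' T').
Proof. by move=> e e' f; split=> -[g [h [/e hg /e' hh ->]]]; exists g, h. Qed.

(** A generator divisible by another one can be dropped, and one that is not
    cannot, so minimality is the antichain property.  The latter compares two
    generators at a time and is easier to check than minimality, which
    quantifies over all subfamilies. *)
Lemma min_mon_gensP (I : pset K n) (s : seq 'X_{1..n}) :
  min_mon_gens I s <->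
  [/\ uniq s, ideal_eq I (mon_ideal s)
    & {in s &, forall u v, (u <= v)%MM -> u = v}].
Proof.
split=> -[us Is h]; split=> //.
  move=> u v uS vS uv; apply/eqP/negPn/negP => neq.
  suff /(_ v vS) : {subset s <= rem v s} by rewrite mem_rem_uniq // inE eqxx.
  apply: h => [w|]; first exact: mem_rem.
  apply: ideal_eq_trans Is _; apply: mon_ideal_eq => w ws; last first.
    by exists w; [exact: mem_rem ws | exact: lepm_refl].
  have [->|nwv] := eqVneq w v.
    by exists u => //; rewrite mem_rem_uniq // inE neq.
  by exists w; rewrite ?lepm_refl // mem_rem_uniq // inE nwv.
move=> t ts It u uS.
have /It/mon_idealX[v vt vu] : I 'X_[u].
  by apply/Is/mon_idealX; exists u; rewrite ?lepm_refl.
by rewrite -(h v u (ts _ vt) uS vu).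
Qed.

Lemma min_mon_gens_mem (I : pset K n) (s t : seq 'X_{1..n}) :
  min_mon_gens I s -> min_mon_gens I t -> s =i t.
Proof.
have sub s' t' : min_mon_gens I s' -> min_mon_gens I t' -> {subset s' <= t'}.
  move=> /min_mon_gensP[_ es as'] /min_mon_gensP[_ et _] u us.
  have /et/mon_idealX[v vt vu] : I 'X_[u].
    by apply/es/mon_idealX; exists u; rewrite ?lepm_refl.
  have /es/mon_idealX[w ws wv] : I 'X_[v].
    by apply/et/mon_idealX; exists v; rewrite ?lepm_refl.
  have wu := as' w u ws us (lepm_trans wv vu).
  suff -> : u = v by [].
  apply/mnmP => i; apply/eqP; rewrite eqn_leq.
  by rewrite (mnm_lepP vu) -{1}wu (mnm_lepP wv).
by move=> hs ht u; apply/idP/idP; apply: sub.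
Qed.

End GeneratedIdeals.

(** * Linear quotients as an exchange property *)

Section LinearQuotients.
Variables (K : fieldType) (n : nat).
Implicit Types (s t : seq 'X_{1..n}) (u v w : 'X_{1..n}).

(** The colon of the generators before u by u is generated by variables iff
    each earlier v admits an earlier w with w : u a single variable dividing
    v : u.  The two inequalities say that w : u divides x and x divides
    v : u. *)
Definition exchange s u :=
  forall v, v \in s -> exists w x,
    [/\ w \in s, (w <= u + U_(x))%MM & (u x < v x)%N].

Definition lq_order s :=
  forall i, (i < size s)%N -> exchange (take i s) (nth 0%MM s i).

Lemma exchange_colon u (A : {set 'I_n}) s :
  ideal_eq (ideal_colon (mon_ideal s : pset K n) 'X_[u]) (var_ideal A) ->
  exchange s u.
Proof.
move=> eA v vs.
have /eA/var_idealP/(_ (v - u)%MM) :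
    ideal_colon (mon_ideal s : pset K n) 'X_[u] 'X_[v - u].
  rewrite /ideal_colon -mpolyXD; apply/mon_idealX; exists v => //.
  by apply/mnm_lepP => i; rewrite mnmDE mnmBE; lia.
rewrite msuppX inE eqxx => /(_ isT)[x xA]; rewrite mnmBE subn_gt0 => lt.
have /eA : var_ideal A ('X_x : {mpoly K[n]}).
  by apply/var_idealP => m; rewrite msuppX inE => /eqP ->; exists x; rewrite // mnm1E eqxx.
rewrite /ideal_colon mpolyXU_mon => /mon_idealX[w ws wu].
by exists w, x; split=> //; rewrite addmC.
Qed.

Lemma colon_exchange s u : exchange s u ->
  ideal_eq (ideal_colon (mon_ideal s : pset K n) 'X_[u])
    (var_ideal [set x | has (fun w => (w <= u + U_(x))%MM) s]).
Proof.
move=> ex f; rewrite /ideal_colon mon_idealP var_idealP; split=> h m mf.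
  have [v vs vm] : exists2 v, v \in s & (v <= m + u)%MM.
    by apply: h; rewrite mem_msuppMX.
  have [w [x [ws wu lt]]] := ex v vs.
  exists x; first by rewrite inE; apply/hasP; exists w.
  by have /mnm_lepP/(_ x) := vm; rewrite mnmDE; lia.
have [m' /h[x] + mx ->] := msuppXM mf.
rewrite inE => /hasP[w ws wu]; exists w => //; apply: lepm_trans wu _.
apply/mnm_lepP => i; rewrite !mnmDE addnC leq_add2r mnm1E.
by case: eqVneq => [<-|].
Qed.

Lemma linear_quotientsP (I : pset K n) :
  linear_quotients I <-> exists2 s, min_mon_gens I s & lq_order s.
Proof.
split=> [[s [ms h]]|[s ms h]]; exists s => //.
  move=> [_ v|i ltis]; first by rewrite take0.
  by have [|A /exchange_colon] := h i.+1; [rewrite ltis | exact].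
split=> // i /andP[_ ltis]; have := colon_exchange (h i ltis) => e.
by eexists; exact: e.
Qed.

End LinearQuotients.

(** * Vertex splittable ideals have linear quotients *)

Section VertexSplittable.
Variables (K : fieldType) (n : nat).
Implicit Types (s t : seq 'X_{1..n}) (u v w : 'X_{1..n}).

(** List the generators of x I1 before those of I2.  For a generator u of I2
    every earlier generator x v of x I1 is divisible by x, which does not
    divide u, and x itself lies in the colon ideal because u, being in I1, is
    a multiple of some generator of I1. *)
Lemma lq_order_split (x : 'I_n) s1 s2 :
  lq_order s1 -> lq_order s2 ->
  (forall u, u \in s2 -> u x = 0%N) ->
  (forall u, u \in s2 -> exists2 v, v \in s1 & (v <= u)%MM) ->
  lq_order ([seq (U_(x) + u)%MM | u <- s1] ++ s2).
Proof.
move=> lq1 lq2 s2x sub i; rewrite size_cat size_map => lti.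
rewrite nth_cat take_cat size_map; case: ltnP => [lt1|ge1] v.
  rewrite -map_take => /mapP[v' /(lq1 i lt1)[w [y [wi wy lty]]] ->].
  exists (U_(x) + w)%MM, y; rewrite (nth_map 0%MM) //; split; first exact: map_f.
    apply/mnm_lepP => j; have /mnm_lepP/(_ j) := wy; rewrite !mnmDE; lia.
  by rewrite !mnmDE; lia.
have lt2 : (i - size s1 < size s2)%N by lia.
set u := nth _ _ _; have us2 : u \in s2 by exact: mem_nth.
rewrite mem_cat => /orP[/mapP[v' v's ->]|]; last first.
  move=> /(lq2 _ lt2)[w [y [wi wy lty]]]; exists w, y; split=> //.
  by rewrite mem_cat wi orbT.
have [w ws wu] := sub u us2; exists (U_(x) + w)%MM, x; split.
- by rewrite mem_cat map_f.
- by apply/mnm_lepP => j; have /mnm_lepP/(_ j) := wu; rewrite !mnmDE; lia.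
- by rewrite s2x // mnmDE mnm1E eqxx.
Qed.

Lemma lq_order1 u : lq_order [:: u].
Proof. by case. Qed.

Lemma vertex_splittable_lq (X : {set 'I_n}) (I : pset K n) :
  vertex_splittable X I ->
  exists s, [/\ min_mon_gens I s, lq_order s
    & forall u, u \in s -> forall i, i \notin X -> u i = 0%N].
Proof.
elim=> {X I} [X I v vX eI|X I eI|X I eI|X I I1 I2 x s1 s2 xX _ IH1 _ IH2 eI sub].
- exists [:: v]; split; [|exact: lq_order1|].
    by apply/min_mon_gensP; split=> // u w; rewrite !inE => /eqP -> /eqP ->.
  by move=> u; rewrite inE => /eqP ->.
- exists [::]; split=> //; apply/min_mon_gensP; split=> // f; rewrite eI.
  rewrite mon_idealP; split=> [->|h]; first by rewrite msupp0.
  by apply: msuppnil0; case: (msupp f) h => // m l /(_ m (mem_head _ _))[].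
- exists [:: 0%MM]; split; [|exact: lq_order1|].
    apply/min_mon_gensP; split=> [//|f|u w]; last by rewrite !inE => /eqP -> /eqP ->.
    rewrite eI mon_idealP; split=> // _ m _; exists 0%MM; rewrite ?mem_head //.
    by apply/mnm_lepP => i; rewrite mnm0E.
  by move=> u; rewrite inE => /eqP -> i _; rewrite mnm0E.
have [t1 [mt1 lq1 X1]] := IH1; have [t2 [mt2 lq2 X2]] := IH2.
move=> ms1 ms2 ms12.
have [/min_mon_gensP[ut1 e1 a1] /min_mon_gensP[ut2 e2 a2]] := (mt1, mt2).
have t2x u : u \in t2 -> u x = 0%N by move=> /X2; apply; rewrite !inE eqxx.
have mt1x : min_mon_gens (ideal_mulX x I1) [seq (U_(x) + u)%MM | u <- t1].
  apply/min_mon_gensP; split.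
  - by rewrite map_inj_uniq //; apply: addmI.
  - exact: ideal_eq_trans (ideal_mulX_ext x e1) (ideal_mulX_mon x t1).
  move=> _ _ /mapP[u ut ->] /mapP[v vt ->] uv; congr (_ + _)%MM; apply: a1 => //.
  by apply/mnm_lepP => i; have /mnm_lepP/(_ i) := uv; rewrite !mnmDE leq_add2l.
exists ([seq (U_(x) + u)%MM | u <- t1] ++ t2); split.
- apply/min_mon_gensP; have /min_mon_gensP[u12 e12 a12] := ms12; split.
  + rewrite cat_uniq map_inj_uniq ?ut1 ?ut2 /= ?andbT; last exact: addmI.
    apply/hasPn => u /t2x ux; apply: contraTN isT => /mapP[v _ eu].
    by move: ux; rewrite eu mnmDE mnm1E eqxx.
  + refine (ideal_eq_trans eI (ideal_eq_trans _ (ideal_add_mon _ _))).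
    apply: ideal_add_ext => //; exact: ideal_eq_trans (ideal_mulX_ext x e1) (ideal_mulX_mon x t1).
  + move=> u v; rewrite !mem_cat => hu hv; apply: a12; rewrite mem_cat.
      by rewrite (min_mon_gens_mem ms1 mt1x) (min_mon_gens_mem ms2 mt2).
    by rewrite (min_mon_gens_mem ms1 mt1x) (min_mon_gens_mem ms2 mt2).
- apply: lq_order_split => // u ut.
  have /sub/e1/mon_idealX[v vt vu] : I2 'X_[u].
    by apply/e2/mon_idealX; exists u; rewrite ?lepm_refl.
  by exists v.
move=> u; rewrite mem_cat => /orP[/mapP[v vt ->]|ut] i iX.
  rewrite mnmDE (X1 v) ?inE ?(negPf iX) ?andbF // mnm1E.
  by case: eqVneq iX => // <-; rewrite xX.
by apply: X2 => //; rewrite inE (negPf iX) andbF.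
Qed.

Lemma vertex_splittable_linear_quotients (X : {set 'I_n}) (I : pset K n) :
  vertex_splittable X I -> linear_quotients I.
Proof.
by case/vertex_splittable_lq => s [ms lq _]; apply/linear_quotientsP; exists s.
Qed.

End VertexSplittable.

(** * Components of ideals with linear quotients *)

Section Components.
Variables (K : fieldType) (n : nat).
Implicit Types (s t : seq 'X_{1..n}) (u v w m : 'X_{1..n}).

Lemma lq_order_sort (r : rel 'X_{1..n}) s :
  total r -> transitive r -> antisymmetric r -> uniq s ->
  (forall u v, u \in s -> v \in s -> r v u -> v != u ->
    exists w x, [/\ w \in s, r w u, w != u, (w <= u + U_(x))%MM
                  & (u x < v x)%N]) ->
  lq_order (sort r s).
Proof.
move=> rtot rtr ras us h i lti v vi.
set L := sort r s in lti vi *; have uL : uniq L by rewrite sort_uniq.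
have vL : v \in L := mem_take vi.
have uiL : nth 0%MM L i \in L by exact: mem_nth.
have sL : sorted r L by exact: sort_sorted.
have lt_r := sorted_ltn_nth rtr 0%MM sL.
have vlt : (index v L < i)%N by rewrite -(in_take i vL).
have rvu : r v (nth 0%MM L i).
  by rewrite -{1}(nth_index 0%MM vL); apply: lt_r; rewrite ?inE ?index_mem.
have neq : v != nth 0%MM L i.
  by rewrite -{1}(nth_index 0%MM vL) nth_uniq ?index_mem // ltn_eqF.
have [||w [x [ws rwu nwu wu lt]]] := h (nth 0%MM L i) v _ _ rvu neq;
  try by rewrite -(mem_sort r).
exists w, x; split=> //; have wL : w \in L by rewrite mem_sort.
rewrite in_take //; case: ltnP => // ile; case/eqP: nwu.
have := nth_index 0%MM wL; case: ltngtP ile => // [lt_i|-> //] _ wE.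
by apply: ras; rewrite rwu -[X in r _ X]wE lt_r ?inE ?index_mem.
Qed.

Definition mons_deg d s : seq 'X_{1..n} :=
  [seq val m | m : 'X_{1..n < d.+1} <- enum {: 'X_{1..n < d.+1}}
     & (mdeg m == d) && has (fun u => (u <= m)%MM) s].

Lemma mem_mons_deg d s m :
  (m \in mons_deg d s) = (mdeg m == d) && has (fun u => (u <= m)%MM) s.
Proof.
apply/mapP/idP => [[m' + ->]|h]; first by rewrite mem_filter => /andP[].
have ltm : (mdeg m < d.+1)%N by case/andP: h => /eqP ->.
by exists (BMultinom ltm) => //; rewrite mem_filter h mem_enum.
Qed.

Lemma mons_deg_uniq d s : uniq (mons_deg d s).
Proof.
rewrite map_inj_uniq => [|m1 m2 /val_inj //].
exact/filter_uniq/enum_uniq.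
Qed.

(** Linear quotients pass to each component.  Attach to a monomial of the
    ideal the first generator u_j dividing it, and order the monomials of
    degree d by j and then lexicographically.  Let m' precede m.
    If the indices differ, the exchange property of the generators gives x
    with u_k dividing x u_j for some k < j, and x divides m' : m since j is
    minimal for m; dropping from x m a variable y != x that occurs in m more
    often than in u_k leaves an earlier monomial of degree d.
    If the indices agree, let y be the first variable in which m and m'
    differ, and trade one y of m for a variable occurring more often in m'. *)
Lemma lq_order_component d s :
  lq_order s -> {in s &, forall u v, (u <= v)%MM -> u = v} ->
  exists2 t, lq_order t & t =i mons_deg d s.
Proof.
move=> lqs anti; pose j m := find (fun u => (u <= m)%MM) s.
pose r m1 m2 := (j m1 < j m2)%N || (j m1 == j m2) && (m1 <= m2)%O.
have rtot : total r.
  by move=> m1 m2; rewrite /r; case: ltngtP => //= _; exact: Order.TotalTheory.le_total.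
have rtr : transitive r.
  move=> m2 m1 m3; rewrite /r => /orP[l12|/andP[/eqP -> l12]] /orP[l23|/andP[/eqP <- l23]].
  - by rewrite (ltn_trans l12 l23).
  - by rewrite l12.
  - by rewrite l23.
  - by rewrite eqxx (Order.POrderTheory.le_trans l12 l23) orbT.
have ras : antisymmetric r.
  move=> m1 m2; rewrite /r; case: ltngtP => //= _ h.
  exact: Order.POrderTheory.le_anti.
exists (sort r (mons_deg d s)); last exact: mem_sort.
apply: lq_order_sort; rewrite ?mons_deg_uniq // => m m'.
have jP m1 : m1 \in mons_deg d s ->
    [/\ mdeg m1 = d, (j m1 < size s)%N & (nth 0%MM s (j m1) <= m1)%MM].
  rewrite mem_mons_deg => /andP[/eqP -> hs]; split; rewrite /j -?has_find //.
  exact: (nth_find 0%MM hs).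
have j_le m1 k : (nth 0%MM s k <= m1)%MM -> (j m1 <= k)%N.
  move=> le; rewrite leqNgt; apply/negP => /(before_find 0%MM).
  by rewrite le.
have swap_mem x y u : mdeg m = d -> u \in s -> (0 < m y)%N ->
    (u <= m - U_(y) + U_(x))%MM -> (m - U_(y) + U_(x))%MM \in mons_deg d s.
  move=> md us my le; rewrite mem_mons_deg; apply/andP; split.
    have /submK e : (U_(y) <= m)%MM by rewrite lep1mP -lt0n.
    by rewrite -md -{2}e !mdegD !mdeg1.
  by apply/hasP; exists u.
have swap_le x y : (m - U_(y) + U_(x) <= m + U_(x))%MM.
  by apply/mnm_lepP => i; rewrite !mnmDE mnmBE; lia.
move=> /jP[md jm um] /jP[m'd jm' um']; rewrite /r.
case/orP=> [ltj _|/andP[/eqP eqj lem] neq].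
  have vi : nth 0%MM s (j m') \in take (j m) s.
    by rewrite -(nth_take 0%MM ltj) mem_nth // size_take jm.
  have [w [x [wi wle ltx]]] := lqs _ jm _ vi.
  have /(nthP 0%MM)[k] := wi; rewrite size_take jm => ltk; rewrite nth_take // => wE.
  have ks : (k < size s)%N := ltn_trans ltk jm.
  have ws : w \in s := mem_take wi.
  have us : nth 0%MM s (j m) \in s by exact: mem_nth.
  set u := nth _ _ _ in us um wle ltx.
  have mx : m x = u x.
    apply/eqP; rewrite eqn_leq (mnm_lepP um) andbT leqNgt; apply/negP => ltux.
    suff /j_le : (nth 0%MM s k <= m)%MM by lia.
    rewrite wE; apply/mnm_lepP => i; have /mnm_lepP/(_ i) := wle.
    have /mnm_lepP/(_ i) := um; rewrite mnmDE mnm1E.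
    by case: eqVneq => [<-|] /=; lia.
  have [y yx ltwy] : exists2 y, y != x & (w y < m y)%N.
    (* otherwise m and w agree away from x, where u is squeezed between them,
       so u and w are comparable *)
    have [/existsP[y /andP[]]|/existsPn no] :=
      boolP [exists y, (y != x) && (w y < m y)%N]; first by exists y.
    have off i : i != x -> u i = w i.
      move=> ix; have := no i; rewrite ix /= -leqNgt => le1.
      have /mnm_lepP/(_ i) := wle; have /mnm_lepP/(_ i) := um.
      rewrite mnmDE mnm1E eq_sym (negPf ix); lia.
    have wu : w = u.
      have [le|lt] := leqP (u x) (w x).
        apply/esym/anti => //; apply/mnm_lepP => i.
        by have [->//|/off ->] := eqVneq i x.
      apply: anti => //; apply/mnm_lepP => i.
      by have [->|/off ->] := eqVneq i x; rewrite // ltnW.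
    by have := j_le m k; rewrite wE wu um => /(_ isT); lia.
  have le : (w <= m - U_(y) + U_(x))%MM.
    apply/mnm_lepP => i; have /mnm_lepP/(_ i) := wle.
    have /mnm_lepP/(_ i) := um; rewrite !mnmDE mnmBE !mnm1E.
    by case: (eqVneq y i) => [<-|_]; rewrite 1?eq_sym ?(negPf yx) /=; lia.
  have ltj' : (j (m - U_(y) + U_(x))%MM < j m)%N.
    by apply: leq_ltn_trans ltk; apply: j_le => //; rewrite wE.
  exists (m - U_(y) + U_(x))%MM, x; split.
  - by apply: (swap_mem x y w) => //; lia.
  - by rewrite ltj'.
  - by apply: contraTneq ltj' => ->; rewrite ltnn.
  - exact: swap_le.
  - by rewrite mx; apply: leq_trans ltx (mnm_lepP um' _).
have deq : mdeg m' = mdeg m by rewrite md.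
have : (m' < m)%O by rewrite Order.POrderTheory.lt_neqAle neq.
case/(ltmcP deq) => y eqy lty.
have [x ltx] : exists x, (m x < m' x)%N.
  have [/existsP//|/existsPn no] := boolP [exists x, (m x < m' x)%N].
  suff : (mdeg m' < mdeg m)%N by rewrite deq ltnn.
  rewrite !mdegE (bigD1 y) //= [ltnRHS](bigD1 y) //= -addSn leq_add //.
  by apply: leq_sum => i _; rewrite leqNgt.
have xy : x != y by apply: contraTneq ltx => ->; rewrite -leqNgt ltnW.
set u := nth _ _ _ in um; have us : u \in s by exact: mem_nth.
rewrite eqj in um'; have my : (0 < m y)%N by lia.
have le : (u <= m - U_(y) + U_(x))%MM.
  apply/mnm_lepP => i; have /mnm_lepP/(_ i) := um; have /mnm_lepP/(_ i) := um'.
  rewrite -/u !mnmDE mnmBE !mnm1E; case: (eqVneq y i) => [<-|_] /=; lia.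
have jle : (j (m - U_(y) + U_(x))%MM <= j m)%N by exact: j_le.
have dsw : mdeg (m - U_(y) + U_(x)) = mdeg m.
  have /submK e : (U_(y) <= m)%MM by rewrite lep1mP -lt0n.
  by rewrite -{2}e !mdegD !mdeg1.
have ltm : ((m - U_(y) + U_(x))%MM < m)%O.
  apply/(ltmcP dsw); exists y => [i iy|]; rewrite mnmDE mnmBE !mnm1E; last first.
    by rewrite eqxx (negPf xy); lia.
  have ix : x != i.
    by apply: contraTneq ltx => ->; rewrite eqy // ltnn.
  by rewrite (negPf ix); case: eqVneq iy => [->|]; rewrite ?ltnn //=; lia.
exists (m - U_(y) + U_(x))%MM, x; split=> //.
- exact: (swap_mem x y u).
- case: (ltngtP (j (m - U_(y) + U_(x))%MM) (j m)) jle => //= _ _.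
  exact: Order.POrderTheory.ltW.
- by apply: contraTneq ltm => ->; rewrite Order.POrderTheory.ltxx.
Qed.

Lemma ideal_degP d (I : pset K n) s f : ideal_eq I (mon_ideal s) ->
  ideal_deg d I f <-> mon_ideal (mons_deg d s) f.
Proof.
move=> eI; split; apply: ideal_gen_min => g.
  move=> [/eI/mon_idealP Ig /dhomogP hg]; apply/mon_idealP => m mg.
  exists m; rewrite ?lepm_refl // mem_mons_deg hg // eqxx /=.
  by have [u us um] := Ig m mg; apply/hasP; exists u.
move=> [m + ->]; rewrite mem_mons_deg => /andP[md /hasP[u us um]].
apply: ideal_gen_id; split; last by rewrite dhomogX.
by apply/eI/mon_idealX; exists u.
Qed.

End Components.

(** * Graded lifting *)

Section GradedMatrices.
Variables (K : fieldType) (n : nat).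
Implicit Types (f g : {mpoly K[n]}).

Definition mfilter (P : pred 'X_{1..n}) f : {mpoly K[n]} :=
  \sum_(m <- msupp f | P m) f@_m *: 'X_[m].

Lemma mcoeff_mfilter P f m : (mfilter P f)@_m = if P m then f@_m else 0.
Proof.
rewrite /mfilter raddf_sum /= big_mkcond /=.
have [mf|mf] := boolP (m \in msupp f).
  rewrite (bigD1_seq m) //= ?msupp_uniq // big1 ?addr0 => [|m' ne].
    by rewrite mcoeffZ mcoeffX eqxx mulr1.
  by case: ifP => // _; rewrite mcoeffZ mcoeffX (negPf ne) mulr0.
rewrite memN_msupp_eq0 // if_same big_seq big1 // => m' m'f.
case: ifP => // _; rewrite mcoeffZ mcoeffX; case: eqVneq => [e|]; rewrite ?mulr0 //.
by rewrite e (negPf mf) in m'f.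
Qed.

(** The map given by M between graded free modules, with row p and column q
    of degrees dr p and dc q, preserves degrees. *)
Definition graded_mx a b (dr : 'I_a -> nat) (dc : 'I_b -> nat)
    (M : 'M[{mpoly K[n]}]_(a, b)) :=
  [forall p, forall q,
    all (fun m => mdeg m + dc q == dr p)%N (msupp (M p q))].

Lemma graded_mxP a b (dr : 'I_a -> nat) (dc : 'I_b -> nat)
    (M : 'M[{mpoly K[n]}]_(a, b)) :
  reflect (forall p q m, m \in msupp (M p q) -> (mdeg m + dc q = dr p)%N)
          (graded_mx dr dc M).
Proof.
apply: (iffP forallP) => [h p q m|h p].
  by have /forallP/(_ q)/allP h' := h p; move=> /h'/eqP.
by apply/forallP => q; apply/allP => m /h ->.
Qed.

Lemma graded_mulmx a b c (da : 'I_a -> nat) (db : 'I_b -> nat)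
    (dc : 'I_c -> nat) (M : 'M[{mpoly K[n]}]_(a, b)) (N : 'M_(b, c)) :
  graded_mx da db M -> graded_mx db dc N -> graded_mx da dc (M *m N).
Proof.
move=> /graded_mxP hM /graded_mxP hN; apply/graded_mxP => p r m; rewrite mxE.
move=> /msupp_sum_le /flatten_mapP[q _] /msuppM_le /allpairsP[[m1 m2] /=].
by case=> /hM e1 /hN e2 ->; rewrite mdegD -addnA e2.
Qed.

(** If a graded matrix factors through a graded matrix D, it does so
    homogeneously: discard from the factor all terms of the wrong degree. *)
Lemma graded_factor a b c (da : 'I_a -> nat) (db : 'I_b -> nat)
    (dc : 'I_c -> nat) (X : 'M[{mpoly K[n]}]_(a, b)) (D : 'M_(b, c)) :
  graded_mx db dc D -> graded_mx da dc (X *m D) ->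
  exists2 Y, graded_mx da db Y & Y *m D = X *m D.
Proof.
move=> /graded_mxP hD /graded_mxP hN.
pose P p q := [pred m : 'X_{1..n} | mdeg m + db q == da p]%N.
exists (\matrix_(p, q) mfilter (P p q) (X p q)).
  apply/graded_mxP => p q m; rewrite mxE mcoeff_msupp mcoeff_mfilter.
  by case: ifP => [/eqP//|]; rewrite eqxx.
apply/matrixP => p r; apply/mpolyP => m.
have [/eqP e|ne] := boolP (mdeg m + dc r == da p)%N; last first.
  rewrite [RHS]memN_msupp_eq0; last by apply: contra ne => /hN ->.
  rewrite memN_msupp_eq0 //; apply: contra ne; rewrite mxE.
  move=> /msupp_sum_le /flatten_mapP[q _] /msuppM_le /allpairsP[[m1 m2] /=].
  case=> + /hD e2 ->; rewrite mdegD -addnA e2 mxE mcoeff_msupp mcoeff_mfilter.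
  by case: ifP => //; rewrite eqxx.
rewrite !mxE !raddf_sum; apply: eq_bigr => q _ /=; rewrite mxE.
apply/eqP; rewrite -subr_eq0 -mcoeffB -mulrBl; apply/eqP.
apply: memN_msupp_eq0; apply/negP => /msuppM_le /allpairsP[[m1 m2] /=].
case=> + /hD e2 em; rewrite mcoeff_msupp mcoeffB mcoeff_mfilter.
have -> : P p q m1 by rewrite /= -e em mdegD -addnA e2.
by rewrite subrr eqxx.
Qed.

Lemma rows_factor a b c (N : 'M[{mpoly K[n]}]_(a, c)) (D : 'M_(b, c)) :
  (forall p, exists v, row p N = v *m D) -> exists X, X *m D = N.
Proof.
move=> /fin_all_exists[v hv]; exists (\matrix_p v p).
by apply/row_matrixP => p; rewrite row_mul rowK hv.
Qed.

Lemma graded_lift a b c (da : 'I_a -> nat) (db : 'I_b -> nat)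
    (dc : 'I_c -> nat) (N : 'M[{mpoly K[n]}]_(a, c)) (D : 'M_(b, c)) :
  graded_mx db dc D -> graded_mx da dc N ->
  (forall p, exists v, row p N = v *m D) ->
  exists2 Y, graded_mx da db Y & Y *m D = N.
Proof.
by move=> hD hN /rows_factor[X e]; move: hN; rewrite -e; apply: (graded_factor hD).
Qed.

End GradedMatrices.

(** * From linear quotients to linear resolutions *)

Section AugmentedComplex.
Variables (K : fieldType) (n : nat) (J : pset K n) (F : graded_resolution J).

(** The resolution of R/J obtained from one of J, with R in position 0. *)
Definition arank i := if i is j.+1 then res_rank F j else 1%N.

Definition adeg i : 'I_(arank i) -> nat :=
  match i with 0%N => fun=> 0%N | j.+1 => @res_deg _ _ _ F j end.

Definition adiff i : 'M[{mpoly K[n]}]_(arank i.+1, arank i) :=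
  match i with 0%N => res_aug F | j.+1 => res_diff F j end.

Lemma adiff_graded i : graded_mx (@adeg i.+1) (@adeg i) (adiff i).
Proof.
apply/graded_mxP; case: i => [|i] p q m mM.
  have /dhomogP/(_ m) := @res_aug_homog _ _ _ F p.
  by rewrite addn0 (ord1 q) in mM * => ->.
have [|le /dhomogP/(_ m mM) /= e] := @res_diff_homog _ _ _ F i p q.
  by apply: contraTneq mM => /= ->; rewrite msupp0.
by rewrite /= e subnK.
Qed.

Lemma adiff_exact i (v : 'rV_(arank i.+1)) :
  v *m adiff i = 0 <-> exists w, v = w *m adiff i.+1.
Proof. by case: i v => [|i] v; [exact: res_exact0 | exact: res_exactS]. Qed.

Lemma adiffK i : adiff i.+1 *m adiff i = 0.
Proof.
apply/row_matrixP => p; rewrite row_mul row0; apply/adiff_exact.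
by exists (delta_mx 0 p); rewrite rowE.
Qed.

Lemma adiff0_image f : J f <-> exists v, v *m adiff 0 = f%:M.
Proof.
rewrite (res_aug_image F); split=> -[v e]; exists v.
  by rewrite [LHS]mx11_scalar -e.
by rewrite e mxE eqxx mulr1n.
Qed.

End AugmentedComplex.

Lemma dependent_choice (T : nat -> choiceType) (P : forall i, pred (T i))
    (r : forall i, T i -> T i.+1 -> bool) x0 :
  P 0%N x0 -> (forall i x, P i x -> exists y, P i.+1 y && r i x y) ->
  exists f : forall i, T i,
    f 0%N = x0 /\ forall i, P i (f i) && r i (f i) (f i.+1).
Proof.
move=> Px0 step.
pose next i (x : {x | P i x}) : {y | P i.+1 y} :=
  exist _ (xchoose (step i (sval x) (svalP x)))
    (proj1 (andP (xchooseP (step i (sval x) (svalP x))))).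
pose f := nat_rect (fun i => {x | P i x}) (exist _ x0 Px0) next.
exists (fun i => sval (f i)); split=> // i; apply/andP; split.
  exact: (svalP (f i)).
by have /andP[] := xchooseP (step i (sval (f i)) (svalP (f i))).
Qed.

Section Cone.
Variables (K : fieldType) (n : nat).
Local Notation R := {mpoly K[n]}.

Definition linear_resolution d (J : pset K n) :=
  exists F : graded_resolution J, forall i p, @res_deg _ _ _ F i p = (d + i)%N.

Lemma linear_resolution_ext d (J J' : pset K n) :
  ideal_eq J J' -> linear_resolution d J -> linear_resolution d J'.
Proof.
move=> e [F hF].
have im f : J' f <-> exists v : 'rV_(res_rank F 0), f = (v *m res_aug F) 0 0.
  by split=> [/e/(res_aug_image F)|/(res_aug_image F)/e].
by exists (GradedResolution (@res_aug_homog _ _ _ F) (@res_diff_homog _ _ _ F) im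
  (@res_exact0 _ _ _ F) (@res_exactS _ _ _ F)).
Qed.

Lemma linear_resolution0 d (J : pset K n) :
  ideal_eq J (@ideal_zero K n) -> linear_resolution d J.
Proof.
move=> J0; pose rk (i : nat) := 0%N; pose dg i (p : 'I_(rk i)) := (d + i)%N.
have v0 k (v : 'M[R]_(k, 0)) : v = 0 by apply/matrixP => ? [].
have im f : J f <-> exists v : 'rV_(rk 0%N), f = (v *m (0 : 'cV[R]_0)) 0 0.
  rewrite J0; split=> [->|[v ->]]; first by exists 0; rewrite mul0mx mxE.
  by rewrite mulmx0 mxE.
have ex k (D : 'M[R]_(0, k)) (v : 'rV[R]_0) :
    v *m D = 0 <-> exists w : 'rV_0, v = w *m (0 : 'M[R]_(0, 0)).
  by rewrite (v0 _ v) mul0mx; split=> // _; exists 0; rewrite mul0mx.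
by exists (@GradedResolution K n J rk dg 0 (fun=> 0) (fun p : 'I_0 =>
  match p with Ordinal _ h => False_ind _ (notF h) end)
  (fun i (p : 'I_0) => match p with Ordinal _ h => False_ind _ (notF h) end)
  im (ex _ _) (fun i => ex _ _)).
Qed.

(** The diagram chase for exactness of a mapping cone.  That the right-hand
    component b of a cycle lifts is a separate hypothesis because at the end of
    the complex it comes from the colon ideal, not from exactness. *)
Lemma cone_exact p p' q s s' (A : 'M[R]_(p, q)) (A' : 'M_(p', p))
    (phi : 'M_(s, q)) (phi' : 'M_(s', p)) (B' : 'M_(s', s)) a b :
  (forall x : 'rV_p, x *m A = 0 -> exists y, x = y *m A') ->
  phi' *m A = B' *m phi -> a *m A + b *m phi = 0 ->
  (exists y : 'rV_s', b = y *m B') ->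
  exists w, row_mx a b = w *m block_mx A' 0 phi' (- B').
Proof.
move=> exA comm ab0 [y bE]; have [|z zE] := exA (a + y *m phi').
  by rewrite mulmxDl -mulmxA comm mulmxA -bE.
exists (row_mx z (- y)); rewrite mul_row_block mulmx0 add0r mulmxN !mulNmx opprK.
by rewrite -bE -zE addrK.
Qed.

Variables (d : nat) (J Q J' : pset K n) (u : R).
Hypotheses (hu : u \is d.-homog) (JQ : ideal_eq Q (ideal_colon J u)).
Hypothesis JJ' : forall f, J' f <-> exists2 g, J g & exists c, f = g + c * u.
Variables (F : graded_resolution J) (G : graded_resolution Q).
Hypothesis hF : forall i p, @res_deg _ _ _ F i p = (d + i)%N.
Hypothesis hG : forall i p, @res_deg _ _ _ G i p = (1 + i)%N.

Local Notation aF := (adiff F).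
Local Notation aG := (adiff G).

Lemma cone_map : exists phi : forall i, 'M[R]_(res_rank G i, res_rank F i),
  [/\ phi 0%N *m aF 0 = u *: aG 0,
      forall i, phi i.+1 *m aF i.+1 = aG i.+1 *m phi i
    & forall i, graded_mx (fun=> 1 + (d + i))%N (fun=> d + i)%N (phi i)].
Proof.
pose P i (M : 'M[R]_(res_rank G i, res_rank F i)) :=
  graded_mx (fun=> 1 + (d + i))%N (fun=> d + i)%N M &&
  (aG i.+1 *m M *m aF i == 0).
pose r i (M : 'M[R]_(res_rank G i, res_rank F i))
  (M' : 'M[R]_(res_rank G i.+1, res_rank F i.+1)) :=
  M' *m aF i.+1 == aG i.+1 *m M.
have gF i : graded_mx (fun=> d + i)%N (@adeg _ _ _ F i) (aF i).
  by apply/graded_mxP => p q m /(graded_mxP _ _ _ (adiff_graded F i)) ->; rewrite /= hF.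
have gG i : graded_mx (fun=> 1 + i)%N (@adeg _ _ _ G i) (aG i).
  by apply/graded_mxP => p q m /(graded_mxP _ _ _ (adiff_graded G i)) ->; rewrite /= hG.
have [phi0 gphi0 phi0E] : exists2 M : 'M[R]_(res_rank G 0, res_rank F 0),
    graded_mx (fun=> 1 + (d + 0))%N (fun=> d + 0)%N M & M *m aF 0 = u *: aG 0.
  apply: graded_lift (gF 0%N) _ _ => [|p].
    apply/graded_mxP => p q m; rewrite mxE => /msuppM_le /allpairsP[[m1 m2] /=].
    case=> /(dhomogP _ _ _ hu) e1 /(graded_mxP _ _ _ (gG 0%N)) e2 ->.
    by move: e2 => /=; rewrite mdegD e1; lia.
  set f := aG 0%N p 0; have : Q f.
    apply/(adiff0_image G); exists (delta_mx 0 p).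
    by rewrite -rowE [LHS]mx11_scalar mxE.
  move=> /JQ /(adiff0_image F)[v vE]; exists v; rewrite vE.
  by apply/rowP => j; rewrite (ord1 j) !mxE eqxx mulr1n mulrC.
have [||phi [phi00 h]] := @dependent_choice _ P r phi0.
- by rewrite /P gphi0 -mulmxA phi0E -scalemxAr adiffK scaler0 /=.
- move=> i M /andP[gM /eqP M0].
  have [M' gM' M'E] : exists2 M' : 'M[R]_(res_rank G i.+1, res_rank F i.+1),
      graded_mx (fun=> 1 + (d + i.+1))%N (fun=> d + i.+1)%N M' &
      M' *m aF i.+1 = aG i.+1 *m M.
    apply: graded_lift (gF i.+1) _ _ => [|p].
      apply: (@graded_mulmx _ _ _ _ _ _ (fun=> 1 + (d + i))%N).
        apply/graded_mxP => p q m /(graded_mxP _ _ _ (adiff_graded G i.+1)).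
        by rewrite /= !hG; lia.
      by apply/graded_mxP => p q m /(graded_mxP _ _ _ gM); rewrite /= hF.
    by apply/adiff_exact; rewrite -row_mul M0 row0.
  exists M'; rewrite /r M'E eqxx andbT /P gM' /=.
  by rewrite -mulmxA M'E mulmxA adiffK mul0mx.
exists phi; split=> [|i|i]; first by rewrite phi00.
- by have /andP[_ /eqP] := h i.
- by have /andP[/andP[]] := h i.
Qed.

(** If (J : u) = Q, then (J + (u))/J is R/Q shifted by the degree of u, and the
    mapping cone of a lift of multiplication by u from the resolution of R/Q
    to that of R/J resolves R/(J + (u)). *)
Lemma linear_resolution_cone : linear_resolution d J'.
Proof.
have [phi [phi0 phiS gphi]] := cone_map.
pose rk i := (res_rank F i + arank G i)%N.
pose dg i (p : 'I_(rk i)) := (d + i)%N.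
pose aug : 'cV[R]_(rk 0%N) := col_mx (aF 0) u%:M.
pose dif i : 'M[R]_(rk i.+1, rk i) :=
  block_mx (aF i.+1) 0 (phi i) (- aG i).
have augE (a : 'rV[R]_(res_rank F 0)) (b : 'rV_1) :
    row_mx a b *m aug = a *m aF 0 + b *m u%:M by rewrite mul_row_col.
have haug p : aug p 0 \is (dg 0%N p).-homog.
  rewrite /aug /dg addn0 mxE; case: split_ordP => j _; last by rewrite mxE ord1.
  apply/dhomogP => m /(graded_mxP _ _ _ (adiff_graded F 0)).
  by rewrite /= hF !addn0.
have gdif i : graded_mx (@dg i.+1) (@dg i) (dif i).
  apply/graded_mxP => p q m; rewrite /dif /dg !mxE.
  case: split_ordP => j _; rewrite !mxE; case: split_ordP => l _.
  - by move=> /(graded_mxP _ _ _ (adiff_graded F i.+1)); rewrite /= !hF.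
  - by rewrite mxE msupp0.
  - by move=> /(graded_mxP _ _ _ (gphi i)); lia.
  rewrite mxE (perm_mem (msuppN _)) => /(graded_mxP _ _ _ (adiff_graded G i)).
  by case: i {p q} j l => [|i] j l /=; rewrite ?hG; lia.
have hdif i p q : dif i p q != 0 ->
    (dg i q <= dg i.+1 p)%N /\ dif i p q \is (dg i.+1 p - dg i q)%N.-homog.
  move=> _; split; first by rewrite /dg leq_add2l.
  by apply/dhomogP => m /(graded_mxP _ _ _ (gdif i)) /= <-; rewrite addnK.
have im f : J' f <-> exists v : 'rV_(rk 0%N), f = (v *m aug) 0 0.
  rewrite JJ'; split=> [[g /(adiff0_image F)[v vE] [c ->]]|[v ->]].
    exists (row_mx v c%:M); rewrite augE vE mul_scalar_mx mxE mxE mxE mxE.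
    by rewrite eqxx !mulr1n.
  rewrite -[v]hsubmxK augE; set a := lsubmx v; set b := rsubmx v.
  exists ((a *m aF 0) 0 0); first by apply/(adiff0_image F); exists a; exact: mx11_scalar.
  by exists (b 0 0); rewrite mxE mul_mx_scalar [(u *: b) _ _]mxE mulrC.
have ex0 (v : 'rV_(rk 0%N)) : v *m aug = 0 <-> exists w, v = w *m dif 0%N.
  split=> [|[w ->]]; last first.
    rewrite -mulmxA mul_block_col (adiffK F) phi0 mul0mx addr0 mulNmx.
    by rewrite mul_mx_scalar subrr col_mx0 mulmx0.
  rewrite -[v]hsubmxK augE; set a := lsubmx v; set b := rsubmx v => ab0.
  apply: (cone_exact (A' := aF 1) (B' := aG 0) _ _ ab0) => [x||]; first by move=> x0; apply/adiff_exact.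
    by rewrite phi0 mul_mx_scalar.
  have [|y yE] := (adiff0_image G (b 0 0)).1; last first.
    by exists y; rewrite yE -mx11_scalar.
  apply/JQ/(adiff0_image F); exists (- a); rewrite mulNmx.
  move/eqP: ab0; rewrite addr_eq0 => /eqP ->; rewrite opprK.
  by rewrite [b in LHS]mx11_scalar -scalar_mxM.
have exS i (v : 'rV_(rk i.+1)) : v *m dif i = 0 <-> exists w, v = w *m dif i.+1.
  split=> [|[w ->]]; last first.
    rewrite -mulmxA mulmx_block (adiffK F) phiS mulNmx subrr.
    rewrite !mul0mx !mulmx0 !add0r mulNmx mulmxN opprK (adiffK G).
    by rewrite block_mx0 mulmx0.
  rewrite -[v]hsubmxK mul_row_block mulmx0 add0r mulmxN.
  set a := lsubmx v; set b := rsubmx v => /eqP; rewrite row_mx_eq0.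
  case/andP => /eqP ab0; rewrite oppr_eq0 => /eqP b0.
  apply: (cone_exact (A' := aF i.+2) (B' := aG i.+1) _ _ ab0) => [x||]; first by move=> x0; apply/adiff_exact.
    by rewrite phiS.
  exact/adiff_exact.
by exists (GradedResolution haug hdif im ex0 exS).
Qed.

End Cone.

Section LinearQuotientsResolution.
Variables (K : fieldType) (n : nat).
Implicit Types (s t : seq 'X_{1..n}) (u v w m : 'X_{1..n}).

Lemma mon_ideal_rcons t u (f : {mpoly K[n]}) :
  mon_ideal (rcons t u) f <->
  exists2 g, mon_ideal t g & exists c, f = g + c * 'X_[u].
Proof.
rewrite -cats1; split=> [/ideal_add_mon[g [h [tg [s [hs ->]] ->]]]|].
  exists g => //; exists (\sum_(cg <- s) cg.1); congr (_ + _).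
  rewrite mulr_suml big_seq [RHS]big_seq; apply: eq_bigr => cg /hs[m].
  by rewrite inE => /eqP -> ->.
move=> [g tg [c ->]]; apply/ideal_add_mon; exists g, (c * 'X_[u]); split=> //.
by apply/ideal_genM/ideal_gen_id; exists u; rewrite ?mem_head.
Qed.

(** A variable outside s is a nonzerodivisor modulo those in s, so adjoining
    it is a cone of the resolution over itself; this rebuilds the Koszul
    complex. *)
Lemma linear_resolution_vars (s : seq 'I_n) : uniq s ->
  linear_resolution 1 (mon_ideal [seq U_(x)%MM | x <- s] : pset K n).
Proof.
elim/last_ind: s => [_|s x IH].
  apply: linear_resolution0 => f; rewrite mon_idealP; split=> [h|->].
    apply: msuppnil0; case: (msupp f) h => // m l /(_ m (mem_head _ _))[] //.
  by rewrite msupp0.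
rewrite rcons_uniq => /andP[xs us]; have [F hF] := IH us.
apply: (@linear_resolution_cone _ _ 1 _ _ _ 'X_x _ _ _ F F hF hF).
- by rewrite dhomogX; apply/eqP; exact: mdeg1.
- move=> f; rewrite /ideal_colon !mon_idealP; split=> h m.
    move=> /msuppXM[m' /h[u us' um] ->]; exists u => //.
    by apply: lepm_trans um _; exact: lem_addr.
  rewrite -(mem_msuppMX U_(x)) => /h[_ /mapP[y ys ->] le].
  exists U_(y)%MM; first exact: map_f.
  move: le; rewrite !lep1mP mnmDE mnm1E; case: (eqVneq x y) => [e|_]; last by rewrite addn0.
  by rewrite e ys in xs.
by move=> f; rewrite map_rcons mon_ideal_rcons.
Qed.

Lemma linear_resolution_var_ideal (A : {set 'I_n}) :
  linear_resolution 1 (var_ideal A : pset K n).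
Proof.
apply: linear_resolution_ext (linear_resolution_vars (enum_uniq A)) => f.
apply: ideal_gen_ext => g; split.
  by move=> [_ /mapP[x + ->] ->]; rewrite mem_enum; exists x.
by move=> [x xA ->]; exists U_(x)%MM; rewrite // map_f ?mem_enum.
Qed.

Lemma linear_resolution_lq d s :
  lq_order s -> (forall u, u \in s -> mdeg u = d) ->
  linear_resolution d (mon_ideal s : pset K n).
Proof.
move=> lqs sd; suff h i : (i <= size s)%N ->
    linear_resolution d (mon_ideal (take i s) : pset K n).
  by rewrite -(take_size s); apply: h.
elim: i => [_|i IH lti].
  rewrite take0; apply: linear_resolution0 => f; rewrite mon_idealP.
  split=> [h|->]; last by rewrite msupp0.
  by apply: msuppnil0; case: (msupp f) h => // m l /(_ m (mem_head _ _))[].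
have [F hF] := IH (ltnW lti); set u := nth 0%MM s i.
have eQ := @colon_exchange K _ _ _ (lqs i lti).
have [G hG] := linear_resolution_var_ideal
  [set x | has (fun w => (w <= u + U_(x))%MM) (take i s)].
apply: (@linear_resolution_cone _ _ d _ _ _ 'X_[u] _ _ _ F G hF hG).
- by rewrite dhomogX; apply/eqP; apply: sd; exact: mem_nth.
- exact: ideal_eq_sym.
by move=> f; rewrite (take_nth 0%MM lti) mon_ideal_rcons.
Qed.

Lemma linear_resolution_has d (J : pset K n) :
  linear_resolution d J -> has_linear_resolution d J.
Proof.
move=> [F hF]; have [r0|r0] := eqVneq (res_rank F 0) 0%N.
  left=> f; rewrite (res_aug_image F); split=> [[v ->]|->].
    rewrite mxE big1 // => i _; suff : False by [].
    by case: i => i; rewrite /= r0.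
  by exists 0; rewrite mul0mx mxE.
right; exists F; split=> [i p q|i j|].
- have [e|/(@res_diff_homog _ _ _ F)[_ h]] := eqVneq (res_diff F i p q) 0.
    by rewrite e mcoeff0.
  by apply: (dhomog_nemf_coeff h); apply/eqP => /(etrans (esym mdeg0)); rewrite !hF; lia.
- rewrite /graded_betti cards_eq0 => /set0Pn[p]; rewrite inE hF => /eqP <-.
  by [].
exists 0%N; rewrite /graded_betti cards_eq0; apply/set0Pn.
have r0' : (0 < res_rank F 0)%N by rewrite lt0n.
by exists (Ordinal r0'); rewrite inE hF.
Qed.

Lemma linear_quotients_componentwise (I : pset K n) :
  linear_quotients I -> componentwise_linear I.
Proof.
move=> /linear_quotientsP[s /min_mon_gensP[_ eI anti] lqs] d.
have [t lqt et] := lq_order_component d lqs anti.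
apply: linear_resolution_has.
apply: (@linear_resolution_ext _ _ _ (mon_ideal t)); last first.
  by apply: linear_resolution_lq => // u; rewrite et mem_mons_deg => /andP[/eqP].
move=> f; rewrite (ideal_degP d f eI) !mon_idealP.
by split=> h m /h[u ut um]; exists u; rewrite // ?et // -et.
Qed.

End LinearQuotientsResolution.

(** * The Koszul complex *)

Section Koszul.
Variables (K : fieldType) (n : nat).
Local Notation R := {mpoly K[n]}.
Implicit Types (S : {set 'I_n}) (m : 'X_{1..n}).

Definition ksign (v : 'I_n) S := odd #|[set u in S | (u < v)%N]|.

Lemma ksignU v u S : u \notin S -> ksign v (u |: S) = (u < v)%N (+) ksign v S.
Proof.
move=> uS; rewrite /ksign; have [lt|ge] := boolP (u < v)%N.
  rewrite (_ : [set t in u |: S | (t < v)%N] = u |: [set t in S | (t < v)%N]).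
    by rewrite cardsU1 inE (negPf uS) /= oddD.
  apply/setP => t; rewrite !inE; case: eqVneq => [->|] //=; by rewrite lt.
congr (odd #|pred_of_set _|); apply/setP => t; rewrite !inE.
by case: eqVneq => [->|] //=; rewrite (negPf ge) andbF.
Qed.

(** An element of the Koszul complex on the variables with coefficients in
    R^r is encoded by its coordinates on the exterior monomials e_S; kd is the
    differential, which contracts with the vector (x_1, ..., x_n). *)
Definition kd r (f : {set 'I_n} -> 'rV[R]_r) S : 'rV[R]_r :=
  \sum_(v | v \notin S) ((-1) ^+ ksign v S * 'X_v) *: f (v |: S).

Lemma eq_kd r (f g : {set 'I_n} -> 'rV[R]_r) : f =1 g -> kd f =1 kd g.
Proof. by move=> e S; apply: eq_bigr => v _; rewrite e. Qed.

Lemma kdB r (f g : {set 'I_n} -> 'rV[R]_r) S :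
  kd (fun S => f S - g S) S = kd f S - kd g S.
Proof. by rewrite /kd -sumrB; apply: eq_bigr => v _; rewrite scalerBr. Qed.

Lemma kd_mulmx r r' (f : {set 'I_n} -> 'rV[R]_r) (A : 'M_(r, r')) S :
  kd (fun S => f S *m A) S = kd f S *m A.
Proof. by rewrite mulmx_suml; apply: eq_bigr => v _; rewrite scalemxAl. Qed.

Lemma kd_kd r (f : {set 'I_n} -> 'rV[R]_r) S : kd (kd f) S = 0.
Proof.
pose T (p : 'I_n * 'I_n) := ((-1) ^+ ksign p.1 S * 'X_(p.1) *
  ((-1) ^+ ksign p.2 (p.1 |: S) * 'X_(p.2))) *: f (p.2 |: (p.1 |: S)).
have -> : kd (kd f) S =
    \sum_(p | [&& p.1 \notin S, p.2 \notin S & p.1 != p.2]) T p.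
  rewrite /kd (eq_bigl (fun p : 'I_n * 'I_n => (p.1 \notin S) &&
    (p.2 \notin p.1 |: S))); last first.
    by move=> p; rewrite !inE negb_or andbCA [p.2 == _]eq_sym andbC -!andbA.
  rewrite -(pair_big_dep (fun v => v \notin S) (fun v u => u \notin v |: S)
    (fun v u => T (v, u))) /=.
  by apply: eq_bigr => v _; rewrite scaler_sumr; apply: eq_bigr => u _; rewrite scalerA.
rewrite (bigID (fun p : 'I_n * 'I_n => p.1 < p.2)%N) /= addrC.
rewrite (reindex (fun p : 'I_n * 'I_n => (p.2, p.1))) /=; last first.
  by exists (fun p => (p.2, p.1)) => [] [].
rewrite [X in X + _](eq_bigl (fun p : 'I_n * 'I_n =>
  [&& p.1 \notin S, p.2 \notin S & p.1 != p.2] && (p.1 < p.2)%N)); last first.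
  move=> [v u] /=; rewrite eq_sym; have [->|ne] := eqVneq v u.
    by rewrite ltnn !andbF.
  by rewrite -leqNgt leq_eqVlt (negPf (ne : (v : nat) != u)) andbCA.
rewrite -big_split big1 //= => -[v u] /= /andP[/and3P[vS uS ne] lt].
rewrite /T /= setUCA -scalerDl !ksignU // lt ltnNge (ltnW lt) /=.
rewrite (_ : _ + _ = 0) ?scale0r //.
by case: (ksign u S); case: (ksign v S); rewrite /= ?expr0 ?expr1; ring.
Qed.

Lemma mcoeffXU_M v (p : R) m :
  ('X_v * p)@_m = if (0 < m v)%N then p@_(m - U_(v)) else 0.
Proof.
rewrite mulrC; case: ifP => mv.
  have {1}<- : (U_(v) + (m - U_(v)))%MM = m.
    by rewrite addmC submK // lep1mP -lt0n.
  exact: mcoeffMX.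
apply: memN_msupp_eq0; apply/negP => /msuppXM[m' _ mE].
by move: mv; rewrite mE mnmDE mnm1E eqxx addn1.
Qed.

Lemma mcoeff_kd r (f : {set 'I_n} -> 'rV[R]_r) S q m :
  (kd f S 0 q)@_m = \sum_(v | (v \notin S) && (0 < m v)%N)
    (-1) ^+ ksign v S * (f (v |: S) 0 q)@_(m - U_(v)).
Proof.
rewrite summxE raddf_sum big_mkcondr /=; apply: eq_bigr => v _.
rewrite mxE; have -> : ((-1) ^+ ksign v S * 'X_v * f (v |: S) 0 q)@_m =
    (-1) ^+ ksign v S * ('X_v * f (v |: S) 0 q)@_m.
  by rewrite -mulrA; case: ksign; rewrite ?expr0 ?expr1 ?mul1r ?mulN1r ?mcoeffN.
by rewrite mcoeffXU_M; case: ifP => // _; rewrite mulr0.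
Qed.

Lemma mpoly_of_coef (c : 'X_{1..n} -> K) N :
  (forall m, (N <= mdeg m)%N -> c m = 0) -> exists p : R, forall m, p@_m = c m.
Proof.
move=> cN; exists (\sum_(m : 'X_{1..n < N}) c m *: 'X_[m]) => m.
have [lt|ge] := ltnP (mdeg m) N; first exact: mcoeff_mpoly.
rewrite cN // raddf_sum big1 //= => m' _; rewrite mcoeffZ mcoeffX.
by case: eqVneq => [e|]; rewrite ?mulr0 //; have := bmdeg m'; rewrite e ltnNge ge.
Qed.

(** The least variable of the multidegree of x^m e_S; see [koszul_exact0]. *)
Definition lowest S m (v : 'I_n) :=
  ((v \in S) || (0 < m v)%N) &&
  [forall u : 'I_n, ((u \in S) || (0 < m u)%N) ==> (v <= u)%N].

Lemma lowest_inj S m u v : lowest S m u -> lowest S m v -> u = v.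
Proof.
move=> /andP[hu /forallP lu] /andP[hv /forallP lv].
have /implyP/(_ hv) := lu v; have /implyP/(_ hu) := lv u.
by move=> le1 le2; apply/val_inj/eqP; rewrite eqn_leq le1 le2.
Qed.

Lemma lowest_move S m t : t \notin S -> (0 < m t)%N ->
  lowest (t |: S) (m - U_(t)) =1 lowest S m.
Proof.
move=> tS mt; have e u : (u \in t |: S) || (0 < (m - U_(t))%MM u)%N =
    (u \in S) || (0 < m u)%N.
  rewrite !inE mnmBE mnm1E; case: (eqVneq t u) => [<-|ne]; last by rewrite subn0.
  by rewrite mt !orbT.
move=> v; rewrite /lowest e; congr (_ && _); apply: eq_forallb => u.
by rewrite e.
Qed.

Lemma lowestP S m : (exists v, lowest S m v) \/ S = set0 /\ m = 0%MM.
Proof.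
have [/existsP[v0 h0]|/existsPn no] := boolP [exists v, (v \in S) || (0 < m v)%N].
  left; case: (@arg_minnP _ v0 [pred v | (v \in S) || (0 < m v)%N] (@nat_of_ord n) h0) => v /= hv min; exists v.
  by rewrite /lowest hv; apply/forallP => u; apply/implyP => /min.
right; split; first by apply/setP => v; have := no v; rewrite inE; case: (v \in S).
by apply/mnmP => v; have := no v; rewrite negb_or mnm0E -eqn0Ngt => /andP[_ /eqP].
Qed.

Lemma ksign_lowest S m v : lowest S m v -> v \notin S -> ksign v S = false.
Proof.
move=> /andP[_ /forallP low] vS; rewrite /ksign (_ : [set u in S | (u < v)%N] = set0).
  by rewrite cards0.
apply/setP => u; rewrite !inE; apply/negP => /andP[uS lt].
by have := low u; rewrite uS /= leqNgt lt.
Qed.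

Definition concentrated r s (f : {set 'I_n} -> 'rV[R]_r) :=
  forall S, #|S| != s -> f S = 0.

(** Exactness of the Koszul complex.  In multidegree b != 0 a contracting
    homotopy is multiplication by e_v / x_v, where v is the least variable
    occurring in b; the monomial x^m e_S has multidegree m plus the indicator
    of S.  Only the constants in homological degree 0 survive. *)
Lemma koszul_exact0 r (f : {set 'I_n} -> 'rV[R]_r) :
  (forall S, kd f S = 0) -> (forall q, (f set0 0 q)@_0%MM = 0) ->
  exists g, forall S, f S = kd g S.
Proof.
move=> kdf f0.
pose c S q m : K := if [pick v | lowest S m v && (v \in S)] is Some v
  then (f (S :\ v) 0 q)@_(m + U_(v)) else 0.
have cE S q m v : lowest S m v ->
    c S q m = if v \in S then (f (S :\ v) 0 q)@_(m + U_(v)) else 0.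
  move=> low; rewrite /c; case: pickP => [u /andP[lu uS]|no].
    by rewrite (lowest_inj low lu) uS.
  by have := no v; rewrite low /= => ->.
have [g gE] : exists g : {set 'I_n} -> 'rV[R]_r,
    forall S q m, (g S 0 q)@_m = c S q m.
  have ex S : exists gS : 'rV[R]_r, forall q m, (gS 0 q)@_m = c S q m.
    have exq q : exists p : R, forall m, p@_m = c S q m.
      refine (@mpoly_of_coef (c S q) (\max_(v : 'I_n) (msize (f (S :\ v) 0 q))%R) _) => m le.
      rewrite /c; case: pickP => // v _; apply: memN_msupp_eq0.
      apply: msize_mdeg_ge; rewrite mdegD; apply: leq_trans (leq_addr _ _).
      by apply: leq_trans le; apply: leq_bigmax.
    have [p hp] := fin_all_exists exq.
    by exists (\row_q p q) => q m; rewrite mxE hp.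
  by have [g hg] := fin_all_exists ex; exists g.
exists g => S; apply/rowP => q; apply/mpolyP => m; rewrite mcoeff_kd.
have [[v low]|[-> ->]] := lowestP S m; last first.
  by rewrite f0 big_pred0 // => v; rewrite mnm0E andbF.
have [vS|vS] := boolP (v \in S); last first.
  have mv : (0 < m v)%N by move: low; rewrite /lowest (negPf vS) => /andP[].
  rewrite (bigD1 v) ?vS //= (ksign_lowest low vS) mul1r big1 ?addr0.
    rewrite gE (cE _ _ _ v) ?lowest_move // setU11 setU1K // submK //.
    by rewrite lep1mP -lt0n.
  move=> t /andP[/andP[tS mt] tv]; rewrite gE (cE _ _ _ v) ?lowest_move //.
  by rewrite !inE eq_sym (negPf tv) (negPf vS) mulr0.
have /(congr1 (fun A : 'rV_r => (A 0 q)@_(m + U_(v)))) := kdf (S :\ v).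
rewrite mcoeff_kd mxE mcoeff0 (bigD1 v) /=; last first.
  by rewrite !inE eqxx mnmDE mnm1E eqxx addn1.
have vD : v \notin S :\ v by rewrite !inE eqxx.
have sg : ksign v (S :\ v) = false.
  apply: (@ksign_lowest _ (m + U_(v))%MM) => //; move: low.
  rewrite /lowest mnmDE mnm1E eqxx addn1 orbT /= => /andP[_ /forallP low].
  apply/forallP => u; apply/implyP => hu; have [->//|uv] := eqVneq u v.
  apply: (implyP (low u)); move: hu.
  by rewrite !inE uv mnmDE mnm1E eq_sym (negPf uv) addn0.
rewrite sg mul1r setD1K // addmK => /eqP; rewrite addr_eq0 => /eqP ->.
rewrite -sumrN; apply: eq_big => [t|t /andP[/andP[tD mt] tv]].
  rewrite !inE mnmDE mnm1E; have [->|tv] := eqVneq t v; first by rewrite vS andbF.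
  by rewrite addn0 andbT.
have tS : t \notin S by move: tD; rewrite !inE tv.
have mt' : (0 < m t)%N by move: mt; rewrite mnmDE mnm1E eq_sym (negPf tv) addn0.
have lt : (v < t)%N.
  have /andP[_ /forallP/(_ t)] := low; rewrite mt' orbT /= leq_eqVlt.
  by case/orP => // /eqP/val_inj e; rewrite e eqxx in tv.
rewrite gE (cE _ _ _ v) ?lowest_move // !inE vS orbT.
rewrite -[in RHS](setD1K vS) ksignU // lt /= signrN mulNr.
have -> : (t |: (v |: S :\ v)) :\ v = t |: S :\ v.
  by rewrite setD1K //; apply/setP => u; rewrite !inE; case: (eqVneq u t) => [->|]; rewrite ?tv.
congr (- (_ * (_ : R)@_ _)).
apply/mnmP => u; rewrite !(mnmDE, mnmBE, mnm1E).
by case: (eqVneq t u) => [<-|_]; lia.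
Qed.

Lemma koszul_exact r s (f : {set 'I_n} -> 'rV[R]_r) :
  concentrated s f -> (forall S, kd f S = 0) ->
  (forall q, (f set0 0 q)@_0%MM = 0) ->
  exists2 g, concentrated s.+1 g & forall S, f S = kd g S.
Proof.
move=> fs kdf f0; have [g gE] := koszul_exact0 kdf f0.
exists (fun S => if #|S| == s.+1 then g S else 0) => S.
  by move=> /negPf ->.
have [sS|sS] := eqVneq #|S| s; last first.
  rewrite fs // /kd big1 // => v vS; rewrite cardsU1 vS add1n eqSS (negPf sS).
  exact: scaler0.
by rewrite gE; apply: eq_bigr => v vS; rewrite cardsU1 vS add1n sS eqxx.
Qed.

End Koszul.

(** * Koszul homology of ideals with a linear resolution *)

Section KoszulChase.
Variables (K : fieldType) (n : nat).
Local Notation R := {mpoly K[n]}.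
Implicit Types (S : {set 'I_n}) (m : 'X_{1..n}).

(** Total degree, with e_S of degree #|S|. *)
Definition kgraded r (dg : 'I_r -> nat) j (f : {set 'I_n} -> 'rV[R]_r) :=
  forall S q m, m \in msupp (f S 0 q) -> (mdeg m + dg q + #|S| = j)%N.

Lemma kd_concentrated r s (f : {set 'I_n} -> 'rV[R]_r) :
  concentrated s.+1 f -> concentrated s (kd f).
Proof.
move=> fs S sS; rewrite /kd big1 // => v vS.
by rewrite fs ?scaler0 // cardsU1 vS add1n eqSS.
Qed.

Lemma kd_graded r (dg : 'I_r -> nat) j (f : {set 'I_n} -> 'rV[R]_r) :
  kgraded dg j f -> kgraded dg j (kd f).
Proof.
move=> fj S q m; rewrite mcoeff_msupp mcoeff_kd => nz.
have [/existsP[v /and3P[vS mv]]|/existsPn no] := boolP [exists v : 'I_n,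
  [&& v \notin S, (0 < m v)%N & (m - U_(v))%MM \in msupp (f (v |: S) 0 q)]].
  move=> /fj; rewrite cardsU1 vS add1n addnS => <-.
  have /submK {1}<- : (U_(v) <= m)%MM by rewrite lep1mP -lt0n.
  by rewrite mdegD mdeg1; lia.
case/eqP: nz; apply: big1 => v /andP[vS mv]; rewrite memN_msupp_eq0 ?mulr0 //.
by have := no v; rewrite vS mv.
Qed.

Variables (J : pset K n) (F : graded_resolution J) (d : nat).
Hypothesis hF : forall i (p : 'I_(res_rank F i)), (res_deg p <= d + i)%N.
Local Notation aF := (adiff F).

Lemma lift_chain l s j (z : {set 'I_n} -> 'rV[R]_(arank F l)) :
  concentrated s z -> kgraded (@adeg _ _ _ F l) j z ->
  (forall S, exists v : 'rV_(res_rank F l), z S = v *m aF l) ->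
  exists f : {set 'I_n} -> 'rV[R]_(res_rank F l),
    [/\ concentrated s f, kgraded (@adeg _ _ _ F l.+1) j f
      & forall S, z S = f S *m aF l].
Proof.
move=> zs zj ex.
have exS S : exists v : 'rV_(res_rank F l), [/\ #|S| != s -> v = 0,
    (forall q m, m \in msupp (v 0 q) ->
       (mdeg m + @adeg _ _ _ F l.+1 q + #|S| = j)%N)
    & z S = v *m aF l].
  have [sS|sS] := eqVneq #|S| s; last first.
    exists 0; split=> // [q m|]; first by rewrite mxE msupp0.
    by rewrite mul0mx zs.
  have [z0|nz] := eqVneq (z S) 0.
    by exists 0; split=> // [q m|]; rewrite ?mxE ?msupp0 // mul0mx z0.
  have leSj : (#|S| <= j)%N.
    have /existsP[q nzq] : [exists q, z S 0 q != 0].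
      apply: contraNT nz => /existsPn no; apply/eqP/rowP => q; rewrite mxE.
      by apply/eqP; have := no q; rewrite negbK.
    by rewrite -(zj S q _ (mlead_supp nzq)) leq_addl.
  have [||v /graded_mxP gv vE] := @graded_lift _ _ 1 _ _ (fun=> j - #|S|)%N
      _ _ (z S) _ (adiff_graded F l).
  - by apply/graded_mxP => p q m; rewrite (ord1 p) => /zj <-; rewrite addnK.
  - by move=> p; have [w wE] := ex S; exists w; rewrite (ord1 p) row_id.
  by exists v; split=> [|q m /gv ->|//]; rewrite ?sS ?eqxx // subnK // -sS.
have [f hf] := fin_all_exists exS; exists f.
by split=> S; have [] := hf S.
Qed.

(** The comparison of the Koszul complex with the resolution.  A Koszul cycle
    with coefficients in F_(l-1) is lifted along the resolution one step at a
    time, its homological degree s decreasing.  For s = 0 the coefficients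
    have degree larger than that of every generator of F_l, hence no
    constant terms, and the Koszul complex is exact there. *)
Lemma koszul_chase s : forall l j (f : {set 'I_n} -> 'rV[R]_(res_rank F l)),
  (d + l + s < j)%N -> concentrated s f -> kgraded (@adeg _ _ _ F l.+1) j f ->
  (forall S, kd f S *m aF l = 0) ->
  exists2 g, concentrated s.+1 g & forall S, f S *m aF l = kd g S *m aF l.
Proof.
elim: s => [|s IH] l j f ltj fs fj cyc.
  have kdf S : kd f S = 0.
    rewrite /kd big1 // => v vS.
    by rewrite fs ?scaler0 // cardsU1 vS.
  have f0 q : (f set0 0 q)@_0%MM = 0.
    apply: memN_msupp_eq0; apply/negP => /fj; rewrite cards0 mdeg0 /=.
    by have := hF q; lia.
  have [g gs fE] := koszul_exact fs kdf f0; exists g => // S; by rewrite fE.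
have [|f' [fs' fj' fE']] := @lift_chain l.+1 s j (kd f) (kd_concentrated fs) (kd_graded fj).
  by move=> S; apply/adiff_exact/cyc.
have [|S|g' gs' gE'] := IH l.+1 j f' _ fs' fj'; first by lia.
  by rewrite -kd_mulmx -(eq_kd fE') kd_kd.
pose h S := f S - g' S *m aF l.+1.
have hs : concentrated s.+1 h by move=> S sS; rewrite /h fs // gs' // mul0mx subr0.
have [S|q|g gs hE] := koszul_exact hs.
- by rewrite kdB kd_mulmx fE' gE' subrr.
- by rewrite hs ?cards0 // mxE mcoeff0.
exists g => // S; rewrite -hE /h mulmxBl -mulmxA.
by rewrite (adiffK F) mulmx0 subr0.
Qed.

Lemma koszul_cycle_boundary s j (w : {set 'I_n} -> 'rV[R]_1) :
  (d + s < j)%N -> concentrated s.+1 w -> kgraded (fun=> 0%N) j w ->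
  (forall S, J (kd w S 0 0)) ->
  exists y a, forall S, w S = y S + kd a S /\ J (y S 0 0).
Proof.
move=> ltj ws wj Jw.
have [|f [fs fj fE]] := @lift_chain 0 s j (kd w) (kd_concentrated ws) (kd_graded wj).
  move=> S; have [v vE] := (adiff0_image F _).1 (Jw S).
  by exists v; rewrite vE -mx11_scalar.
have [|S|g gs gE] := koszul_chase _ fs fj; first by rewrite addn0.
  by rewrite -kd_mulmx -(eq_kd fE) kd_kd.
pose h S := w S - g S *m aF 0.
have hs : concentrated s.+1 h by move=> S sS; rewrite /h ws // gs // mul0mx subr0.
have [S|q|a _ hE] := koszul_exact hs.
- by rewrite kdB kd_mulmx fE gE subrr.
- by rewrite hs ?cards0 // mxE mcoeff0.
exists (fun S => g S *m aF 0), a => S; split; first by rewrite -hE addrC subrK.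
by apply/(adiff0_image F); exists (g S); exact: mx11_scalar.
Qed.

End KoszulChase.

Section KoszulCertificate.
Variables (K : fieldType) (n : nat).
Local Notation R := {mpoly K[n]}.
Implicit Types (S T : {set 'I_n}) (m u : 'X_{1..n}).

(** If J has a d-linear resolution, its Koszul homology in homological degree s
    lives in degree d + s.  Applied to the cycle kd (x^u e_T), which has
    coefficients in J, this expresses x^u e_T as a chain with coefficients
    in J plus a boundary; outside J only the boundary contributes. *)
Lemma linear_koszul d (G : pset K n) T u (J := ideal_gen G) :
  has_linear_resolution d J ->
  (forall f m, J f -> m \in msupp f -> J 'X_[m]) ->
  T != set0 -> (d <= mdeg u)%N ->
  (forall v, v \in T -> J 'X_[u + U_(v)]) ->
  exists a : {set 'I_n} -> 'X_{1..n} -> K, forall S m, ~ J 'X_[m] ->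
    ((S == T) && (m == u))%:R =
    \sum_(v | (v \notin S) && (0 < m v)%N)
      (-1) ^+ ksign v S * a (v |: S) (m - U_(v))%MM.
Proof.
move=> lin Jmon T0 du JT.
pose w S : 'rV[R]_1 := if S == T then ('X_[u])%:M else 0.
have [s sT] : exists s, #|T| = s.+1.
  by exists #|T|.-1; rewrite prednK // card_gt0.
have ws : concentrated s.+1 w.
  by move=> S; rewrite /w; case: (eqVneq S T) => // ->; rewrite sT eqxx.
have wj : kgraded (fun=> 0%N) (mdeg u + s.+1) w.
  move=> S q m; rewrite /w; case: eqVneq => [->|_]; last by rewrite mxE msupp0.
  by rewrite (ord1 q) mxE eqxx mulr1n msuppX inE sT => /eqP ->; rewrite addn0.
have wE S m : (w S 0 0)@_m = ((S == T) && (m == u))%:R.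
  rewrite /w; case: (eqVneq S T) => _; last by rewrite mxE mcoeff0.
  by rewrite mxE eqxx mulr1n mcoeffX eq_sym.
have [y [a ya]] : exists y a, forall S, w S = y S + kd a S /\
    forall m, ~ J 'X_[m] -> (y S 0 0)@_m = 0.
  case: lin => [J0|[F [_ hb _]]].
    (* J contains a monomial, as T is not empty *)
    have /set0Pn[v /JT/J0/eqP] := T0.
    by rewrite -msupp_eq0 msuppX.
  have hF i (p : 'I_(res_rank F i)) : (res_deg p <= d + i)%N.
    apply: hb; rewrite /graded_betti -lt0n card_gt0; apply/set0Pn; exists p.
    by rewrite inE.
  have [||y [a ya]] := koszul_cycle_boundary hF _ ws wj.
  - by lia.
  - move=> S; rewrite /kd summxE.
    rewrite -big_filter; apply: ideal_gen_sum => v.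
    rewrite mem_filter mxE /w => _; case: eqVneq => [eT|_]; last first.
      by rewrite mxE mulr0; exact: ideal_gen0.
    rewrite mxE eqxx mulr1n -mulrA mpolyXU_mon addmC.
    by apply/ideal_genM/JT; rewrite -eT setU11.
  exists y, a => S; have [-> Jy] := ya S; split=> // m nJ.
  by apply: memN_msupp_eq0; apply/negP => /(Jmon _ _ Jy).
exists (fun S m => (a S 0 0)@_m) => S m nJ.
have [wS yS] := ya S; rewrite -wE wS mxE mcoeffD yS // add0r; exact: mcoeff_kd.
Qed.

End KoszulCertificate.

(** * Weighted oriented graphs and their edge ideals *)

Section Graph.
Variables (n : nat) (D : wograph n).
Hypothesis hsink : forall x, x \in Vplus D -> sink D x.
Implicit Types (S C T : {set 'I_n}) (m : 'X_{1..n}).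

Lemma adjC : symmetric (adj D).
Proof. by move=> x y; rewrite /adj orbC. Qed.

Lemma edge_neq x y : edge D x y -> x != y.
Proof. by move=> e; apply: contraTneq (e) => ->; apply/negP => e'; have := edge_asym e'; rewrite e'. Qed.

Lemma adj_irr : irreflexive (adj D).
Proof. by move=> x; apply/negP => /orP[] /edge_neq; rewrite eqxx. Qed.

Lemma weight1 x : x \notin Vplus D -> weight D x = 1%N.
Proof. by rewrite inE; have := weight_gt0 D x; lia. Qed.

Lemma weight_tail x y : edge D x y -> weight D x = 1%N.
Proof.
by move=> e; apply: weight1; apply: contraTN e => /hsink; apply.
Qed.

Lemma Vplus_nadj x y : x \in Vplus D -> y \in Vplus D -> ~~ adj D x y.
Proof. by move=> /hsink hx /hsink hy; rewrite negb_or hx hy. Qed.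

Definition edge_mon x y : 'X_{1..n} := (U_(x) + U_(y) *+ weight D y)%MM.

Lemma edge_monE x y i : edge_mon x y i = ((x == i) + (y == i) * weight D y)%N.
Proof. by rewrite mnmDE mulmnE !mnm1E. Qed.

Definition edge_mons S : seq 'X_{1..n} :=
  [seq edge_mon p.1 p.2 | p : 'I_n * 'I_n <- enum [pred p : 'I_n * 'I_n |
     [&& edge D p.1 p.2, p.1 \in S & p.2 \in S]]].

Lemma edge_monsP S m :
  reflect (exists x y, [/\ edge D x y, x \in S, y \in S & m = edge_mon x y])
          (m \in edge_mons S).
Proof.
apply: (iffP mapP) => [[[x y]]|[x [y [e xS yS ->]]]].
  by rewrite mem_enum inE /= => /and3P[e xS yS] ->; exists x, y.
by exists (x, y); rewrite // mem_enum inE /= e xS.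
Qed.

Lemma edge_ideal_mon (K : fieldType) :
  ideal_eq (edge_ideal K D) (mon_ideal (edge_mons setT)).
Proof.
move=> f; apply: ideal_gen_ext => g; split.
  move=> [x [y [e ->]]]; exists (edge_mon x y).
    by apply/edge_monsP; exists x, y; rewrite !inE.
  by rewrite mpolyXn -mpolyXD.
move=> [_ /edge_monsP[x [y [e _ _ ->]]] ->]; exists x, y; split=> //.
by rewrite mpolyXn -mpolyXD.
Qed.

End Graph.

(** * Obstructions to componentwise linearity *)

Section Obstructions.
Variables (K : fieldType) (n : nat) (D : wograph n).
Hypothesis hsink : forall x, x \in Vplus D -> sink D x.
Implicit Types (S C T : {set 'I_n}) (m : 'X_{1..n}).

Local Notation J d := (ideal_deg d (edge_ideal K D)).

Lemma mnm_between (u m : 'X_{1..n}) d : (u <= m)%MM -> (mdeg u <= d <= mdeg m)%N ->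
  exists2 v, (u <= v)%MM && (v <= m)%MM & mdeg v = d.
Proof.
move=> um /andP[/subnKC <-]; move: (d - mdeg u)%N => k.
elim: k u um => [|k IH] u um.
  by rewrite addn0 => _; exists u; rewrite // lepm_refl.
move=> ltm; have [i lti] : exists i, (u i < m i)%N.
  have [/existsP//|/existsPn no] := boolP [exists i, (u i < m i)%N].
  suff le : (mdeg m <= mdeg u)%N.
    by have := leq_trans ltm le; rewrite -[leqRHS]addn0 leq_add2l.
  by rewrite !mdegE leq_sum // => i _; rewrite leqNgt.
have dU : mdeg (u + U_(i)) = (mdeg u).+1 by rewrite mdegD mdeg1 addn1.
have [||v /andP[uv vm] dv] := IH (u + U_(i))%MM.
- apply/mnm_lepP => t; rewrite mnmDE mnm1E; have /mnm_lepP/(_ t) := um.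
  by case: eqVneq => [<-|_] /=; lia.
- by rewrite dU addSnnS.
rewrite dU addSnnS in dv.
exists v => //; rewrite vm andbT; apply: lepm_trans uv; exact: lem_addr.
Qed.

Lemma component_mon d f m : J d f -> m \in msupp f -> J d 'X_[m].
Proof.
have e g := ideal_degP d g (@edge_ideal_mon _ D K); move=> /e/mon_idealP h /h um.
by apply/e/mon_idealX.
Qed.

Lemma componentX d m : J d 'X_[m] ->
  exists x y, edge D x y /\ (edge_mon D x y <= m)%MM.
Proof.
move/(ideal_degP d _ (@edge_ideal_mon _ D K))/mon_idealX => [u + um].
rewrite mem_mons_deg => /andP[_ /hasP[_ /edge_monsP[x [y [e _ _ ->]]] le]].
by exists x, y; split=> //; apply: lepm_trans le um.
Qed.

Lemma edge_component d m x y : edge D x y -> (edge_mon D x y <= m)%MM ->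
  (mdeg (edge_mon D x y) <= d <= mdeg m)%N -> J d 'X_[m].
Proof.
move=> e le /(mnm_between le)[u /andP[lu um] du].
apply/(ideal_degP d _ (@edge_ideal_mon _ D K))/mon_idealX; exists u => //.
rewrite mem_mons_deg du eqxx; apply/hasP; exists (edge_mon D x y) => //.
by apply/edge_monsP; exists x, y; rewrite !inE.
Qed.

Hypothesis CL : componentwise_linear (edge_ideal K D).

Section Cycle.
Variables (C : {set 'I_n}) (c0 c1 : 'I_n).
Local Notation e := (compl_graph (adj D)).
Hypotheses (c0C : c0 \in C) (c1C : c1 \in C) (ec01 : e c0 c1).
Hypothesis Cgt2 : exists2 v, v \in C & (v != c0) && (v != c1).
Hypothesis no_triangle : forall v, v \in C -> v != c0 -> v != c1 ->
  adj D c0 v || adj D c1 v.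

(* for T a subset of C, the monomial that accompanies e_T in multidegree
   b set0 *)
Let b T : 'X_{1..n} :=
  [multinom if i \in C then (weight D i - (i \in T))%N else 0%N | i < n].

Lemma cycle_nonface u v m : u \in C -> v \in C -> e u v ->
  m = b (C :\: [set u; v]) -> forall d, ~ J d 'X_[m].
Proof.
move=> uC vC /andP[uv nadj] mE d /componentX[x [y [exy /mnm_lepP le]]].
have nxy := edge_neq exy.
have in_uv t : (weight D t <= m t)%N -> t \in [set u; v].
  rewrite mE mnmE; case: ifP => tC; last by rewrite leqNgt weight_gt0.
  rewrite in_setD tC andbT; case: (t \in [set u; v]) => //=.
  by rewrite leqNgt ltn_subrL weight_gt0.
have xuv : x \in [set u; v].
  apply: in_uv; apply: leq_trans (le x).
  by rewrite edge_monE eqxx (weight_tail hsink exy) leq_addr.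
have yuv : y \in [set u; v].
  by apply: in_uv; apply: leq_trans (le y); rewrite edge_monE eqxx mul1n leq_addl.
case/negP: nadj; rewrite /adj; move: xuv yuv nxy exy.
by rewrite !inE => /orP[] /eqP -> /orP[] /eqP ->; rewrite ?eqxx // => _ ->; rewrite ?orbT.
Qed.

(** In multidegree b set0 a Koszul basis element e_S, S a subset of C, occurs
    with coefficients in the edge ideal iff C \ S contains an edge: this is
    the simplicial complex dual to the clique complex of the complement graph
    on C.  Take T = C \ {c0, c1}.  The Koszul boundary of e_T has coefficients
    in the edge ideal, but e_T itself does not, and its degree lies just above
    the linear strand of the component of degree mdeg (b T).  Hence e_T is, up to
    elements e_S with C \ S an edge, the boundary of a combination of the
    e_(C \ v); the coefficients of the latter, with signs, are the
    potential p. *)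
Lemma cycle_potential : exists p : 'I_n -> K,
  p c0 != p c1 /\
  forall u v, u \in C -> v \in C -> e u v -> [set u; v] != [set c0; c1] ->
    p u = p v.
Proof.
pose T := C :\: [set c0; c1]; pose d := mdeg (b T).
have bU S t : t \in C -> t \notin S -> (b S - U_(t))%MM = b (t |: S).
  move=> tC tS; apply/mnmP => i; rewrite mnmBE !mnmE in_setU1 [i == t]eq_sym.
  case: eqVneq => [<-|_] /=; last by rewrite subn0.
  by rewrite tC (negPf tS) subn0.
have [||v vT|a aE] := linear_koszul (T := T) (u := b T) (CL d) (@component_mon d).
- have [v vC /andP[v0 v1]] := Cgt2; apply/set0Pn; exists v.
  by rewrite !inE vC (negPf v0) (negPf v1).
- exact: leqnn.
- have [vC v0 v1] : [/\ v \in C, v != c0 & v != c1].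
    by move: vT; rewrite !inE negb_or => /andP[/andP[]].
  have face x y t : edge D x y -> x \in [set c0; c1; v] ->
      y \in [set c0; c1; v] -> t \in [set c0; c1; v] -> t != x -> t != y ->
      J d 'X_[b T + U_(v)].
    move=> exy xs ys ts tx ty.
    have full i : i \in [set c0; c1; v] -> (b T + U_(v))%MM i = weight D i.
      rewrite mnmDE mnmE mnm1E !inE -orbA => /or3P[] /eqP ->.
      - by rewrite c0C eqxx /= (negPf v0) addn0 subn0.
      - by rewrite c1C eqxx orbT /= (negPf v1) addn0 subn0.
      - by rewrite vC (negPf v0) (negPf v1) eqxx /= subnK // weight_gt0.
    have le : (edge_mon D x y + U_(t) <= b T + U_(v))%MM.
      apply/mnm_lepP => i; rewrite [leqLHS]mnmDE edge_monE mnm1E.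
      have [<-|xi] := eqVneq x i.
        rewrite full // (negPf tx) eq_sym (negPf (edge_neq exy)).
        by rewrite (weight_tail hsink exy).
      have [<-|yi] := eqVneq y i; first by rewrite full // (negPf ty) mul1n addn0.
      by have [<-|ti] := eqVneq t i; first by rewrite full // weight_gt0.
    have := mnm_lepP le => {}le'.
    apply: (edge_component exy).
      by apply: lepm_trans le; exact: lem_addr.
    rewrite mdegD mdeg1 addn1 leqnSn andbT -/d.
    have : (mdeg (edge_mon D x y + U_(t)) <= mdeg (b T + U_(v)))%N.
      by rewrite [in leqLHS]mdegE [in leqRHS]mdegE leq_sum.
    by rewrite !mdegD !mdeg1 leq_add2r.
  have c01 : c0 != c1 by case/andP: ec01.
  case/orP: (no_triangle vC v0 v1) => /orP[] exy.
  - by apply: (face _ _ c1 exy); rewrite ?inE ?eqxx ?orbT // eq_sym.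
  - by apply: (face _ _ c1 exy); rewrite ?inE ?eqxx ?orbT // eq_sym.
  - by apply: (face _ _ c0 exy); rewrite ?inE ?eqxx ?orbT // eq_sym.
  - by apply: (face _ _ c0 exy); rewrite ?inE ?eqxx ?orbT // eq_sym.
pose p v : K := (-1) ^+ ksign v C * a (C :\ v) (b (C :\ v)).
have key u v : u \in C -> v \in C -> e u v ->
    (([set u; v] == [set c0; c1])%:R : K) != 0 <-> p u != p v.
  move=> uC vC euv; have uv : u != v by case/andP: euv.
  pose S := C :\: [set u; v].
  have := aE S (b S) (cycle_nonface uC vC euv erefl (d := d)).
  have -> : (S == T) && (b S == b T) = ([set u; v] == [set c0; c1]).
    apply/andP/eqP => [[/eqP ST _]|uvE]; last by rewrite /S /T uvE !eqxx.
    have uvC : [set u; v] \subset C by rewrite subUset !sub1set uC.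
    have cC : [set c0; c1] \subset C by rewrite subUset !sub1set c0C.
    have dd (A : {set _}) : A \subset C -> A = C :\: (C :\: A).
      by move=> AC; rewrite setDDr setDv set0U; apply/esym/setIidPr.
    by rewrite [LHS](dd _ uvC) [RHS](dd _ cC) -/S -/T ST.
  move=> ->.
  have uS : u \notin S by rewrite !inE eqxx.
  have vS : v \notin S by rewrite !inE eqxx orbT.
  have eSu : u |: S = C :\ v.
    apply/setP => t; rewrite !inE; have [->|tu] := eqVneq t u; first by rewrite uv uC.
    by [].
  have eSv : v |: S = C :\ u.
    apply/setP => t; rewrite !inE; have [->|tv] := eqVneq t v.
      by rewrite eq_sym uv vC.
    by rewrite orbF.
  rewrite (bigD1 u) /=; last by rewrite uS mnmE uC (negPf uS) subn0 weight_gt0.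
  rewrite (bigD1 v) /=; last by rewrite vS mnmE vC (negPf vS) subn0 weight_gt0 eq_sym.
  rewrite big1 ?addr0 => [|t]; last first.
    rewrite mnmE => /andP[/andP[/andP[tS +] tu] tv]; case: ifP => // tC _.
    by move: tS; rewrite !inE tC (negPf tu) (negPf tv).
  rewrite (bU S u uC uS) (bU S v vC vS) eSu eSv.
  have ku : ksign u C = (v < u)%N (+) ksign u S.
    by rewrite -[in LHS](setD1K vC) ksignU ?inE ?eqxx // -eSu ksignU // ltnn.
  have kv : ksign v C = (u < v)%N (+) ksign v S.
    by rewrite -[in LHS](setD1K uC) ksignU ?inE ?eqxx // -eSv ksignU // ltnn.
  set A := a _ _; set B := a _ _.
  have -> : (-1) ^+ ksign u S * A + (-1) ^+ ksign v S * B =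
      (-1) ^+ (ksign u S (+) ksign v S (+) (v < u)%N) * (p u - p v).
    rewrite /p -/A -/B ku kv; move: uv; rewrite -val_eqE /=.
    case: ltngtP => //= _ _; case: (ksign u S); case: (ksign v S);
    rewrite /= ?expr0 ?expr1; ring.
  by rewrite mulf_eq0 signr_eq0 subr_eq0.
exists p; split.
  by apply/(key c0 c1 c0C c1C ec01); rewrite eqxx oner_eq0.
move=> u v uC vC euv ne; apply/eqP/negPn/negP => /(key u v uC vC euv).
by rewrite (negPf ne) eqxx.
Qed.

End Cycle.

(** Around an induced cycle of the complement the potential would be constant
    along all edges of the cycle but one, where it jumps. *)
Lemma componentwise_chordal : chordal (compl_graph (adj D)).
Proof.
move=> c [/andP[cyc uc] chord]; rewrite leqNgt; apply/negP => size4.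
case: c size4 cyc uc chord => [|c0 [|c1 [|c2 [|c3 r]]]] // _ cyc uc chord.
set e := compl_graph (adj D) in cyc chord.
set c := [:: c0, c1, c2, c3 & r] in cyc uc chord.
pose C : {set 'I_n} := [set x in c].
have inC x : (x \in C) = (x \in c) by rewrite inE.
have [c0C c1C c2C] : [/\ c0 \in C, c1 \in C & c2 \in C].
  by rewrite !inC !inE !eqxx !orbT.
have /and3P[ec01 ec12 pth] : [&& e c0 c1, e c1 c2 & path e c2 (rcons (c3 :: r) c0)].
  by [].
move: (uc); rewrite /= !inE !negb_or -!andbA.
case/and5P=> n01 n02 n03 nr0 /and4P[n12 n13 nr1 /and3P[n23 nr2 _]].
have no_triangle v : v \in C -> v != c0 -> v != c1 -> adj D c0 v || adj D c1 v.
  move=> vC v0 v1; apply: contraTT isT; rewrite negb_or => /andP[na0 na1].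
  have e0 : e c0 v by rewrite /e /compl_graph eq_sym v0.
  have e1 : e c1 v by rewrite /e /compl_graph eq_sym v1.
  rewrite inC in vC.
  have nx0 : next c c0 = c1 by rewrite /= eqxx.
  have nx1 : next c c1 = c2 by rewrite /= eq_sym (negPf n01) eqxx.
  have nx2 : next c c2 = c3.
    by rewrite /= eq_sym (negPf n02) eq_sym (negPf n12) eqxx.
  have c0c : c0 \in c by rewrite -inC.
  have c1c : c1 \in c by rewrite -inC.
  have vE : v = c2.
    have /orP[/eqP -> //|/eqP nv] := chord c1 v c1c vC e1.
    by move: nv v0; rewrite -nx0 => /(can_inj (prev_next uc)) <-; rewrite eqxx.
  have := chord c0 v c0c vC e0.
  by rewrite nx0 (negPf v1) vE nx2 (negPf n03).
have [|p [p01 pE]] := cycle_potential c0C c1C ec01 _ no_triangle.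
  by exists c2; rewrite // eq_sym n02 eq_sym n12.
suff const s x : path e x (rcons s c0) -> x \in C -> x != c0 ->
    all (fun y => [&& y \in C, y != c0 & y != c1]) s ->
    (x == c1) ==> (s != [::]) -> p x = p c0.
  case/eqP: p01; apply/esym/(const [:: c2, c3 & r]) => //.
  - by rewrite /= ec12; exact: pth.
  - by rewrite eq_sym.
  - apply/allP => y ys; rewrite inE /c 2!inE ys !orbT /=.
    by apply/andP; split; apply: contraTneq ys => ->;
      rewrite !inE !negb_or ?n02 ?n03 ?n12 ?n13.
  - by rewrite implybT.
have C01 t y : y != c0 -> y != c1 -> [set t; y] != [set c0; c1].
  move=> y0 y1; apply/eqP => /setP/(_ y).
  by rewrite !inE eqxx orbT (negPf y0) (negPf y1).
elim: s x => [|y s IH] x /=.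
  rewrite andbT implybF => exc xC x0 _ x1.
  by apply: pE => //; rewrite setUC C01.
case/andP=> exy pth' xC x0 /andP[/and3P[yC y0 y1] hs] _.
rewrite (pE x y) ?C01 //; apply: IH => //.
by rewrite (negPf y1).
Qed.

(** Neighbours y, z of x in V+, of weights p <= q, give a relation between
    multiples of x y^p and x z^q in degree p + q + 1.  It is minimal for the
    component of degree q + 1, where linearity only allows degree q + 2. *)
Lemma componentwise_nbhd x : (#|nbhd D x :&: Vplus D| <= 1)%N.
Proof.
rewrite leqNgt; apply/negP => /card_gt1P[y [z []]]; rewrite !inE.
move=> /andP[xy yV] /andP[xz zV] yz.
wlog le : y z xy yV xz zV yz / (weight D y <= weight D z)%N.
  by move=> H; have [/H|/ltnW/H] := leqP (weight D y) (weight D z); apply; rewrite // eq_sym.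
have sink_edge t : adj D x t -> (1 < weight D t)%N -> edge D x t.
  move=> a wt; have /hsink/(_ x) : t \in Vplus D by rewrite inE.
  by move: a; rewrite /adj => /orP[//|->].
have exy := sink_edge y xy yV; have exz := sink_edge z xz zV.
have [nxy nxz] := (edge_neq exy, edge_neq exz).
set p := weight D y in yV le; set q := weight D z in zV le.
pose u : 'X_{1..n} := (U_(x) + U_(y) *+ p.-1 + U_(z) *+ q.-1)%MM.
pose m : 'X_{1..n} := (U_(y) *+ p.-1 + U_(z) *+ q)%MM.
have uE i : u i = ((x == i) + (y == i) * p.-1 + (z == i) * q.-1)%N.
  by rewrite !mnmDE !mulmnE !mnm1E.
have mE i : m i = ((y == i) * p.-1 + (z == i) * q)%N.
  by rewrite !mnmDE !mulmnE !mnm1E.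
have du : mdeg u = (p + q).-1.
  by rewrite !mdegD !mdegMn !mdeg1 !mul1n; lia.
have not_tail s t : edge D s t -> s != y /\ s != z.
  move=> est; have sy : sink D y by apply: hsink; rewrite inE.
  have sz : sink D z by apply: hsink; rewrite inE.
  split; apply: contraTneq est => ->; [exact: sy | exact: sz].
have [||v|a aE] := linear_koszul (T := [set y; z]) (u := u) (CL q.+1)
    (@component_mon q.+1).
- by apply/set0Pn; exists y; rewrite !inE eqxx.
- by rewrite du; lia.
- rewrite !inE => /orP[] /eqP ->.
    apply: (edge_component exy); last first.
      rewrite !mdegD !mdegMn !mdeg1 -/p; lia.
    apply/mnm_lepP => i; rewrite edge_monE mnmDE uE mnm1E -/p.
    by case: (eqVneq y i) => [<-|_] /=; lia.
  apply: (edge_component exz); last first.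
    rewrite !mdegD !mdegMn !mdeg1 -/q; lia.
  apply/mnm_lepP => i; rewrite edge_monE mnmDE uE mnm1E -/q.
  by case: (eqVneq z i) => [<-|_] /=; lia.
have nu : ~ J q.+1 'X_[u].
  move=> /componentX[s [t [est /mnm_lepP le1]]].
  have [sy sz] := not_tail s t est; have nst := edge_neq est.
  have sx : x = s.
    have := le1 s; rewrite edge_monE uE eqxx (eq_sym y) (eq_sym z).
    by rewrite (negPf sy) (negPf sz); case: (eqVneq x s).
  have : (weight D t <= u t)%N.
    by apply: leq_trans (le1 t); rewrite edge_monE eqxx mul1n leq_addl.
  rewrite uE sx (negPf nst); have [<-|_] := eqVneq y t.
    by rewrite eq_sym (negPf yz) mul1n addn0 leqNgt -/p prednK ?leqnn // ltnW.
  have [<-|_] := eqVneq z t; last by rewrite leqNgt weight_gt0.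
  by rewrite mul1n leqNgt -/q prednK ?leqnn // ltnW.
have nm : ~ J q.+1 'X_[m].
  move=> /componentX[s [t [est /mnm_lepP/(_ s)]]].
  have [sy sz] := not_tail s t est.
  by rewrite edge_monE mE eqxx (eq_sym y) (eq_sym z) (negPf sy) (negPf sz).
have := aE [set x; y] _ nm; have := aE [set y; z] _ nu.
rewrite !eqxx (bigD1 x) /=; last by rewrite !inE negb_or nxy nxz uE eqxx.
rewrite big1 ?addr0 => [|v]; last first.
  rewrite !inE uE negb_or ![v == _]eq_sym => /andP[/andP[/andP[vy vz]]].
  by rewrite (negPf vy) (negPf vz); case: eqVneq.
have -> : ([set x; y] == [set y; z]) = false.
  by apply/negbTE/eqP => /setP/(_ x); rewrite !inE eqxx (negPf nxy) (negPf nxz).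
rewrite (bigD1 z) /=; last first.
  by rewrite !inE negb_or eq_sym nxz eq_sym yz mE eqxx; lia.
rewrite big1 ?addr0 => [|v]; last first.
  rewrite !inE mE negb_or ![v == _]eq_sym => /andP[/andP[/andP[vx vy]]].
  by rewrite (negPf vy); case: eqVneq.
have -> : (z |: [set x; y]) = (x |: [set y; z]).
  by apply/setP => i; rewrite !inE orbC orbA.
have -> : (m - U_(z))%MM = (u - U_(x))%MM.
  apply/mnmP => i; rewrite !mnmBE uE mE !mnm1E.
  by case: (eqVneq z i) => [<-|_]; rewrite ?(negPf nxz) ?(negPf yz) /=; lia.
move=> e1 /esym/eqP; rewrite mulf_eq0 signr_eq0 /= => /eqP a0.
by move/eqP: e1; rewrite a0 mulr0 oner_eq0.
Qed.

End Obstructions.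

(** * Simplicial vertices of chordal graphs *)

Section Simplicial.
Local Open Scope nat_scope.
Variables (T : finType) (e : rel T).
Hypotheses (e_sym : symmetric e) (e_irr : irreflexive e) (e_chordal : chordal e).
Implicit Types (A B S Z : {set T}) (v s : T).

Definition simplicial S s :=
  forall a b, a \in S -> b \in S -> a != b -> e s a -> e s b -> e a b.

Lemma path_cut x t i l : path e x t -> (i < l <= size t)%N ->
  ((l < size t)%N -> e (nth x (x :: t) i) (nth x t l)) ->
  path e x (take i t ++ drop l t).
Proof.
move=> pt /andP[il lt] jump; rewrite cat_path.
have [pti _] : path e x (take i t) /\ path e (last x (take i t)) (drop i t).
  by apply/andP; rewrite -cat_path cat_take_drop.
rewrite pti /= (last_nth x) size_takel ?(leq_trans (ltnW il)) //.
have -> : nth x (x :: take i t) i = nth x (x :: t) i.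
  by case: (i) => //= k; rewrite nth_take.
have : path e (last x (take l t)) (drop l t).
  by move: pt; rewrite -{1}(cat_take_drop l t) cat_path => /andP[].
have [ge|ltl] := leqP (size t) l; first by rewrite drop_oversize.
by rewrite (drop_nth x ltl) /= jump // => /andP[].
Qed.

(** Two nonadjacent neighbours z1, z2 of v are not joined by a path whose
    other vertices avoid the neighbourhood of v: a shortest one would close
    up through v to an induced cycle of length at least 4. *)
Lemma no_detour v z1 z2 B t :
  (forall b, b \in B -> b != v /\ ~~ e b v) ->
  e z1 v -> e z2 v -> z1 != z2 -> ~~ e z1 z2 ->
  path e z1 t -> last z1 t = z2 ->
  {in t, forall x, [|| x \in B, x == z1 | x == z2]} -> False.
Proof.
move=> Bv z1v z2v z12 nz12; have [k] := ubnP (size t).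
elim: k t => // k IH t ltk pt lt tB.
pose q i := nth z1 (z1 :: t) i.
have lq : q (size t) = z2 by rewrite -lt /q -last_nth.
have nocut i l : (i < l <= size t)%N -> ((l < size t)%N -> e (q i) (nth z1 t l)) ->
    (l = size t -> q i = z2) -> False.
  move=> il jump end_; apply: (IH (take i t ++ drop l t)).
  - case/andP: il => il lt'; rewrite size_cat size_drop size_takel ?(leq_trans (ltnW il)) //.
    rewrite -ltnS; apply: leq_trans ltk; rewrite ltnS.
    by rewrite -[X in _ < X](subnKC lt') ltn_add2r.
  - exact: path_cut.
  - case/andP: il => il; rewrite leq_eqVlt => /orP[/eqP lE|ltl]; last first.
      have : last z1 (take l t ++ drop l t) = z2 by rewrite cat_take_drop.
      by rewrite !last_cat (drop_nth z1 ltl).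
    rewrite lE drop_size cats0 (last_nth z1) size_takel -?lE ?(ltnW il) //.
    rewrite -(end_ lE) /q; by case: (i) => //= j; rewrite nth_take.
  - by move=> x; rewrite mem_cat => /orP[/mem_take|/mem_drop]; apply: tB.
have step i : (i < size t)%N -> e (q i) (nth z1 t i) by move/(pathP z1): pt; apply.
have uq : uniq (z1 :: t).
  apply/negPn/negP => /(uniqPn z1)[i [j [ij jt eq_ij]]].
  apply: (nocut i j); first by rewrite ij.
    by move=> lj; rewrite /q eq_ij; apply: step.
  by move=> jE; rewrite /q eq_ij jE.
have chord i l : (i < l < size t)%N -> ~~ e (q i) (nth z1 t l).
  move=> /andP[il lt']; apply/negP => eil.
  by apply: (nocut i l) => //; [rewrite il ltnW | move=> lE; rewrite lE ltnn in lt'].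
have tge2 : (1 < size t)%N.
  case: (t) lt pt => [|y [|//]] /=; first by move=> z; rewrite z eqxx in z12.
  by move=> ->; rewrite andbT (negPf nz12).
have qNv x : x \in z1 :: t -> x != v.
  have zv z : e z v -> z != v by apply: contraTneq => ->; rewrite e_irr.
  rewrite inE => /orP[/eqP -> |/tB/or3P[/Bv[]//|/eqP ->|/eqP ->]]; exact: zv.
have uc : uniq (v :: z1 :: t).
  rewrite cons_uniq uq andbT; apply/negP => /qNv; by rewrite eqxx.
have nextE x : x \in z1 :: t ->
    next (v :: z1 :: t) x = nth v t (index x (z1 :: t)).
  move=> xq; rewrite next_nth inE xq orbT /= eq_sym (negPf (qNv x xq)) /=.
  by case: eqP.
suff : (size (v :: z1 :: t) <= 3)%N by rewrite /= !ltnS leqNgt tge2.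
apply: e_chordal; split.
  rewrite /ucycle uc andbT /= e_sym z1v /= rcons_path pt lt; exact: z2v.
have next_lt x y : x \in z1 :: t -> y \in z1 :: t -> e x y ->
    (index x (z1 :: t) < index y (z1 :: t))%N -> y == next (v :: z1 :: t) x.
  move=> xq yq exy lti; rewrite nextE //; set i := index x _ in lti *.
  have [xE yE] : q i = x /\ q (index y (z1 :: t)) = y by rewrite /q !nth_index.
  have := yq; rewrite -index_mem; case: (index y _) lti yE => // l il yE.
  rewrite ltnS => ltl; rewrite -yE in exy *; rewrite -xE in exy.
  move: il; rewrite ltnS leq_eqVlt => /orP[/eqP ->|il].
    by rewrite /q /= (set_nth_default z1).
  by have := chord i l; rewrite il ltl => /(_ isT); rewrite exy.
have next_v y : y \in z1 :: t -> e v y ->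
    (y == next (v :: z1 :: t) v) || (v == next (v :: z1 :: t) y).
  move=> yq evy; have /orP[/eqP ->|/eqP ->] : (y == z1) || (y == z2).
  - move: yq; rewrite inE => /orP[-> //|/tB/or3P[/Bv[_]|->|->]]; rewrite ?orbT //.
    by rewrite e_sym evy.
  - by rewrite /= eqxx eqxx.
  rewrite (nextE z2) -?lq ?index_uniq ?nth_default ?eqxx ?orbT //.
  by rewrite /q mem_nth.
move=> x y; rewrite [x \in _]in_cons [y \in _]in_cons => /orP[/eqP ->|xq] /orP[/eqP ->|yq].
- by rewrite e_irr.
- exact: next_v.
- by rewrite e_sym orbC => /next_v; apply.
move=> exy; have [lti|lti|eqi] := ltngtP (index x (z1 :: t)) (index y (z1 :: t)).
- by rewrite (next_lt x y).
- by rewrite (next_lt y x) ?orbT // e_sym.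
- have xy : x = y by rewrite -(nth_index z1 xq) eqi nth_index.
  by rewrite xy e_irr in exy.
Qed.

(** Dirac's theorem, in a form suited to induction.  Let B be a component of
    the non-neighbours of v.  The neighbours Z of v that touch B form a clique,
    and the neighbours of B lie in B and Z, so a vertex of B that is
    simplicial in B and Z is simplicial in S. *)
Lemma chordal_simplicial S v u : v \in S -> u \in S -> u != v -> ~~ e u v ->
  exists s, [/\ s \in S, s != v, ~~ e s v & simplicial S s].
Proof.
have [k] := ubnP #|S|; elim: k S v u => // k IH S v u ltk vS uS uv nuv.
pose W := [set x in S | (x != v) && ~~ e x v].
pose e' := [rel x y | [&& x \in W, y \in W & e x y]].
pose B := [set x | connect e' u x].
pose Z := [set z in S | e z v && [exists b in B, e z b]].
have uW : u \in W by rewrite inE uS uv.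
have BW x : x \in B -> x \in W.
  rewrite inE => /connectP[p]; elim/last_ind: p => [_ ->//|p y _].
  by rewrite rcons_path last_rcons => /andP[_ /and3P[_ yW _]] ->.
have uB : u \in B by rewrite inE connect0.
have BS x : x \in B -> x \in S by move/BW; rewrite inE => /andP[].
have Bv x : x \in B -> x != v /\ ~~ e x v by move/BW; rewrite inE => /and3P[_ ->].
have e'_sym : connect_sym e'.
  apply: sym_connect_sym => x y /=.
  by rewrite e_sym andbCA.
have nbB b x : b \in B -> x \in S -> e b x -> x \in B :|: Z.
  move=> bB xS ebx; rewrite in_setU orbC inE xS /=; have [exv|nexv] := boolP (e x v).
    by apply/orP; left; apply/existsP; exists b; rewrite bB e_sym.
  have xW : x \in W.
    rewrite inE xS nexv andbT; apply: contraTneq ebx => ->.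
    by case: (Bv b bB).
  by move: (bB); rewrite !inE => ub; apply: connect_trans ub (connect1 _); rewrite /= BW // xW.
have Zclique z1 z2 : z1 \in Z -> z2 \in Z -> z1 != z2 -> e z1 z2.
  rewrite !inE => /and3P[z1S z1v /existsP[b1 /andP[b1B e1]]].
  move=> /and3P[z2S z2v /existsP[b2 /andP[b2B e2]]] z12.
  apply/negPn/negP => nz12.
  have /connectP[p pp lp] : connect e' b1 b2.
    by move: b1B b2B; rewrite !inE e'_sym; apply: connect_trans.
  apply: (@no_detour v z1 z2 B (b1 :: rcons p z2)) => //.
  - rewrite /= e1 rcons_path -lp e_sym e2 andbT /=.
    by apply: sub_path pp => x y /and3P[].
  - by rewrite /= last_rcons.
  move=> x; rewrite inE mem_rcons inE => /or3P[/eqP ->|->|xp]; rewrite ?b1B ?orbT //.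
  have : x \in B; last by move=> ->.
  rewrite inE; move: b1B; rewrite inE => c1; apply: connect_trans c1 _.
  by apply: (path_connect pp); rewrite inE xp orbT.
suff [s [sB sS']] : exists s, s \in B /\ simplicial (B :|: Z) s.
  have [sv nsv] := Bv s sB; exists s; split=> //; first exact: BS.
  move=> a b aS bS ab esa esb.
  by apply: (sS' a b _ _ ab esa esb); apply: (nbB s).
have S'S : B :|: Z \subset S.
  by apply/subsetP => x; rewrite in_setU => /orP[/BS//|]; rewrite inE => /andP[].
have ltS' : (#|B :|: Z| < k)%N.
  rewrite -ltnS; apply: leq_trans ltk; rewrite ltnS.
  apply: proper_card; apply/properP; split=> //; exists v => //.
  rewrite in_setU negb_or inE [v \in Z]inE e_irr andbF andbT.
  by apply/negP => vB; have := Bv v; rewrite inE vB eqxx => -[].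
have [/existsP[z /andP[zZ /existsP[w /and3P[wS' wz nwz]]]]|/existsPn noz] :=
  boolP [exists z in Z, [exists w in B :|: Z, (w != z) && ~~ e w z]].
  have zS' : z \in B :|: Z by rewrite in_setU zZ orbT.
  have [s [sS' sz nsz sim]] := IH _ z w ltS' zS' wS' wz nwz.
  exists s; split=> //; move: sS'; rewrite in_setU => /orP[//|sZ].
  by rewrite (Zclique s z) in nsz.
have Zuniv z w : z \in Z -> w \in B :|: Z -> w != z -> e w z.
  move=> zZ wS' wz; have := noz z; rewrite zZ => /existsPn/(_ w).
  by rewrite wS' wz negbK.
have [/existsP[a /andP[aS' /existsP[w /and3P[wS' wa nwa]]]]|/existsPn noa] :=
  boolP [exists a in B :|: Z, [exists w in B :|: Z, (w != a) && ~~ e w a]].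
  have [s [sS' sa nsa sim]] := IH _ a w ltS' aS' wS' wa nwa.
  exists s; split=> //; move: sS'; rewrite in_setU => /orP[//|sZ].
  by move: nsa; rewrite e_sym (Zuniv s a) // eq_sym.
exists u; split=> // a b aS' bS' ab _ _.
have := noa b; rewrite bS' => /existsPn/(_ a).
by rewrite aS' ab negbK.
Qed.

End Simplicial.

(** * Splitting the edge ideal at a simplicial vertex *)

Section EdgeIdealSplitting.
Variables (K : fieldType) (n : nat) (D : wograph n).
Hypothesis hsink : forall x, x \in Vplus D -> sink D x.
Implicit Types (A S X : {set 'I_n}) (I J : pset K n).

Lemma vertex_splittable_ext X I J :
  ideal_eq I J -> vertex_splittable X I -> vertex_splittable X J.
Proof.
move=> + vs; case: X I / vs => [X I v vX eI|X I eI|X I eI|X I I1 I2 x s1 s2 xX v1 v2 eI sub m1 m2 m12] e.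
all: have eJ := ideal_eq_trans (ideal_eq_sym e) eI.
- exact: VSmon vX eJ.
- exact: VSzero.
- exact: VSfull.
apply: (VSsplit xX v1 v2 eJ sub m1 m2).
have /min_mon_gensP[u es a] := m12; apply/min_mon_gensP; split=> //.
exact: ideal_eq_trans (ideal_eq_sym e) es.
Qed.

Lemma mon_ideal_mem (s t : seq 'X_{1..n}) : s =i t ->
  ideal_eq (mon_ideal s : pset K n) (mon_ideal t).
Proof.
by move=> st; apply: mon_ideal_eq => u ut; exists u; rewrite ?lepm_refl // ?st // -st.
Qed.

Definition pure_mon y : 'X_{1..n} := (U_(y) *+ weight D y)%MM.

Definition pure_mons A := [seq pure_mon y | y <- enum A].

Lemma pure_monE y i : pure_mon y i = ((y == i) * weight D y)%N.
Proof. by rewrite mulmnE mnm1E. Qed.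

Lemma pure_mon_le y z : (pure_mon y <= pure_mon z)%MM -> y = z.
Proof.
move/mnm_lepP/(_ y); rewrite !pure_monE eqxx mul1n => le.
by apply/eqP; rewrite eq_sym; apply: contraLR le => /negPf ->; rewrite -ltnNge weight_gt0.
Qed.

Lemma pure_mon_inj : injective pure_mon.
Proof. by move=> y z e; apply: pure_mon_le; rewrite e lepm_refl. Qed.

Lemma pure_monsP A m : reflect (exists2 y, y \in A & m = pure_mon y) (m \in pure_mons A).
Proof.
by apply: (iffP mapP) => -[y yA ->]; exists y; rewrite // ?mem_enum // -mem_enum.
Qed.

Lemma pure_mons_min A : min_mon_gens (mon_ideal (pure_mons A) : pset K n) (pure_mons A).
Proof.
apply/min_mon_gensP; split=> //.
  by rewrite map_inj_uniq ?enum_uniq //; exact: pure_mon_inj.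
by move=> _ _ /pure_monsP[y _ ->] /pure_monsP[z _ ->] /pure_mon_le ->.
Qed.

(** The variables of weight 1 are split off one at a time, I = y R + I'; the
    single power that may remain is principal.  Two proper powers of distinct
    variables could not be split. *)
Lemma pure_vertex_splittable A X : A \subset X -> (#|A :&: Vplus D| <= 1)%N ->
  vertex_splittable X (mon_ideal (pure_mons A) : pset K n).
Proof.
have [k] := ubnP #|A|; elim: k A X => // k IH A X ltk AX A1.
have [/existsP[y /andP[yA yV]]|/existsPn no] := boolP [exists y in A, y \notin Vplus D].
  have yE : pure_mon y = (U_(y) + 0)%MM.
    by rewrite /pure_mon weight1 // mulm1n addm0.
  have e1 : ideal_eq (ideal_mulX y (fun=> True) : pset K n) (mon_ideal [:: pure_mon y]).
    rewrite yE; refine (ideal_eq_trans _ (@ideal_mulX_mon K n y [:: 0%MM])).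
    apply: ideal_mulX_ext => f; split=> // _; apply/mon_idealP => m _.
    by exists 0%MM; rewrite ?mem_head //; apply/mnm_lepP => i; rewrite mnm0E.
  have cons_mem : [:: pure_mon y] ++ pure_mons (A :\ y) =i pure_mons A.
    move=> m; rewrite mem_cat inE; apply/orP/pure_monsP.
      case=> [/eqP ->|/pure_monsP[z]]; first by exists y.
      by rewrite !inE => /andP[_ zA] ->; exists z.
    move=> [z zA ->]; have [->|zy] := eqVneq z y; first by left.
    by right; apply/pure_monsP; exists z; rewrite // !inE zy.
  have dec : ideal_eq (mon_ideal (pure_mons A) : pset K n)
      (ideal_add (ideal_mulX y (fun=> True)) (mon_ideal (pure_mons (A :\ y)))).
    apply: ideal_eq_sym; refine (ideal_eq_trans (ideal_add_ext e1 (ideal_eq_refl _)) _).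
    exact: ideal_eq_trans (ideal_add_mon _ _) (mon_ideal_mem cons_mem).
  apply: (@VSsplit _ _ _ _ _ _ y [:: pure_mon y] (pure_mons (A :\ y)) _ _ _ dec) => //.
  - exact: (subsetP AX).
  - exact: VSfull.
  - apply: IH; first by rewrite (cardsD1 y) yA in ltk.
      exact: setSD.
    by apply: leq_trans A1; apply/subset_leq_card/setSI; rewrite subD1set.
  - by apply/min_mon_gensP; split=> // u v; rewrite !inE => /eqP -> /eqP ->.
  - exact: pure_mons_min.
  apply/min_mon_gensP; have /min_mon_gensP[u1 _ _] := pure_mons_min (A :\ y).
  have /min_mon_gensP[_ _ a] := pure_mons_min A; split.
  - rewrite /= u1 andbT; apply/negP => /pure_monsP[z + /pure_mon_inj yz].
    by rewrite -yz !inE eqxx.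
  - by apply: mon_ideal_mem => m; rewrite cons_mem.
  - by move=> u v; rewrite !cons_mem; apply: a.
have AV : A \subset Vplus D.
  by apply/subsetP => y yA; have := no y; rewrite yA negbK.
rewrite (setIidPl AV) in A1; move: A1; rewrite leq_eqVlt ltnS leqn0 cards_eq0.
case/orP => [/cards1P[z zE]|/eqP ->]; last first.
  apply: VSzero => f; rewrite /pure_mons enum_set0 mon_idealP.
  split=> [h|->]; last by rewrite msupp0.
  by apply: msuppnil0; case: (msupp f) h => // m l /(_ m (mem_head _ _))[].
apply: (@VSmon _ _ _ _ (pure_mon z)); last by rewrite /pure_mons zE enum_set1.
move=> i iX; rewrite pure_monE; case: eqVneq iX => // <-.
by rewrite (subsetP AX) // zE inE.
Qed.

Lemma edge_mon_le a b c d : edge D a b -> edge D c d ->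
  (edge_mon D a b <= edge_mon D c d)%MM -> (a, b) = (c, d).
Proof.
move=> eab ecd /mnm_lepP le.
have supp i : (0 < edge_mon D a b i)%N -> (i == c) || (i == d).
  move=> h; have := leq_trans h (le i); rewrite edge_monE !(eq_sym i).
  by case: (c == i); case: (d == i).
have /orP[] : (a == c) || (a == d) by apply: supp; rewrite edge_monE eqxx.
  move=> /eqP ac; have /orP[/eqP bc|/eqP -> //] : (b == c) || (b == d).
  - by apply: supp; rewrite edge_monE eqxx mul1n addn_gt0 weight_gt0 orbT.
  - by have := edge_neq eab; rewrite ac bc eqxx.
  - by rewrite ac.
move=> /eqP ad; have /orP[/eqP bc|/eqP bd] : (b == c) || (b == d).
- by apply: supp; rewrite edge_monE eqxx mul1n addn_gt0 weight_gt0 orbT.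
- by have := edge_asym eab; rewrite ad bc ecd.
- by have := edge_neq eab; rewrite ad bd eqxx.
Qed.

Lemma edge_mons_min S : min_mon_gens (mon_ideal (edge_mons D S) : pset K n) (edge_mons D S).
Proof.
apply/min_mon_gensP; split=> //.
  rewrite map_inj_in_uniq ?enum_uniq // => -[a b] [c d].
  rewrite !mem_enum !inE /= => /and3P[eab _ _] /and3P[ecd _ _] e.
  by apply: edge_mon_le; rewrite // e lepm_refl.
move=> _ _ /edge_monsP[a [b [eab _ _ ->]]] /edge_monsP[c [d [ecd _ _ ->]]].
by move=> /(edge_mon_le eab ecd)[-> ->].
Qed.

Local Notation e := (compl_graph (adj D)).

Lemma e_symmetric : symmetric e.
Proof. by move=> x y; rewrite /compl_graph eq_sym adjC. Qed.

Lemma e_irreflexive : irreflexive e.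
Proof. by move=> x; rewrite /compl_graph eqxx. Qed.

(** V+ is a clique of the complement.  So if the first simplicial vertex found
    is in V+, a second one adjacent to it in G is not. *)
Lemma simplicial_not_Vplus S x y : chordal e ->
  x \in S -> y \in S -> adj D x y ->
  exists s, [/\ s \in S, s \notin Vplus D & simplicial e S s].
Proof.
move=> ch; have dirac a b : a \in S -> b \in S -> adj D a b ->
    exists s, [/\ s \in S, adj D s b & simplicial e S s].
  move=> aS bS ab; have ne : a != b by apply: contraTneq ab => ->; rewrite adj_irr.
  have [|s [sS sb nsb sim]] :=
    chordal_simplicial e_symmetric e_irreflexive ch bS aS ne _.
    by rewrite /compl_graph ab andbF.
  exists s; split=> //; apply: contraR nsb => h; by rewrite /compl_graph sb.
move=> xS yS xy; have [s [sS sy sim]] := dirac x y xS yS xy.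
have [sV|sV] := boolP (s \in Vplus D); last by exists s.
have [t [tS ts sim']] := dirac y s yS sS (etrans (adjC _ _ _) sy).
by exists t; split=> //; apply: contraTN ts => tV; apply: Vplus_nadj.
Qed.

(** Splitting at a simplicial vertex x of the complement that has weight 1:
    I = x N + I', where N is generated by the w(y)-th powers of the neighbours
    y of x and I' is the edge ideal without x.  Non-neighbours of x are
    pairwise nonadjacent in G, so each edge not through x meets a neighbour of
    x and I' lies in N. *)
Lemma edge_mons_vertex_splittable S : chordal e ->
  (forall x, #|nbhd D x :&: Vplus D| <= 1)%N ->
  vertex_splittable S (mon_ideal (edge_mons D S) : pset K n).
Proof.
move=> ch nb; have [k] := ubnP #|S|; elim: k S => // k IH S ltk.
have [/existsP[y /andP[yS /existsP[z /andP[zS yz]]]]|/existsPn no] :=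
  boolP [exists y in S, [exists z in S, adj D y z]]; last first.
  have E0 : edge_mons D S =i [::].
    move=> m; rewrite in_nil; apply/negP => /edge_monsP[a [b [eab aS bS _]]].
    have := no a; rewrite aS => /existsPn/(_ b).
    by rewrite bS /adj eab.
  apply: VSzero; refine (ideal_eq_trans (mon_ideal_mem E0) _) => f.
  rewrite mon_idealP; split=> [h|->]; last by rewrite msupp0.
  by apply: msuppnil0; case: (msupp f) h => // m l /(_ m (mem_head _ _))[].
have [x [xS xV sim]] := simplicial_not_Vplus ch yS zS yz.
have wx : weight D x = 1%N := weight1 xV.
pose N := [set y in S | adj D x y].
have mem : [seq (U_(x) + u)%MM | u <- pure_mons N] ++ edge_mons D (S :\ x)
    =i edge_mons D S.
  move=> m; rewrite mem_cat; apply/orP/edge_monsP.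
    case=> [/mapP[_ /pure_monsP[a + ->] ->]|/edge_monsP[a [b [eab]]]]; last first.
      by rewrite !inE => /andP[_ aS] /andP[_ bS] ->; exists a, b.
    rewrite inE => /andP[aS /orP[exa|eax]]; first by exists x, a.
    exists a, x; split=> //.
    by rewrite /edge_mon /pure_mon (weight_tail hsink eax) wx !mulm1n addmC.
  move=> [a [b [eab aS bS ->]]]; have [ax|ax] := eqVneq a x.
    left; apply/mapP; exists (pure_mon b); last by rewrite /edge_mon ax.
    by apply/pure_monsP; exists b; rewrite // inE bS /adj -ax eab.
  have [bx|bx] := eqVneq b x; last first.
    by right; apply/edge_monsP; exists a, b; rewrite !inE ax bx.
  left; apply/mapP; exists (pure_mon a).
    by apply/pure_monsP; exists a; rewrite // inE aS /adj -bx eab orbT.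
  by rewrite /edge_mon /pure_mon bx wx (weight_tail hsink eab) !mulm1n addmC.
have /min_mon_gensP[_ _ aS] := edge_mons_min S.
have /min_mon_gensP[uN _ _] := pure_mons_min N.
have /min_mon_gensP[uS' _ _] := edge_mons_min (S :\ x).
have uxN : uniq [seq (U_(x) + u)%MM | u <- pure_mons N].
  by rewrite map_inj_uniq //; exact: addmI.
have NS : N \subset S :\ x.
  apply/subsetP => a; rewrite !inE => /andP[-> xa]; rewrite andbT.
  by apply: contraTneq xa => ->; rewrite adj_irr.
apply: (@VSsplit _ _ _ _ (mon_ideal (pure_mons N)) (mon_ideal (edge_mons D (S :\ x)))
  x [seq (U_(x) + u)%MM | u <- pure_mons N] (edge_mons D (S :\ x))) => //.
- apply: pure_vertex_splittable => //; apply: leq_trans (nb x).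
  by apply/subset_leq_card/setSI/subsetP => a; rewrite !inE => /andP[].
- by apply: IH; rewrite (cardsD1 x) xS in ltk.
- apply: ideal_eq_sym.
  refine (ideal_eq_trans (ideal_add_ext (ideal_mulX_mon _ _) (ideal_eq_refl _)) _).
  exact: ideal_eq_trans (ideal_add_mon _ _) (mon_ideal_mem mem).
- apply: ideal_gen_min => g [_ /edge_monsP[a [b [eab + + ->]]] ->].
  rewrite !inE => /andP[ax aS'] /andP[bx bS'].
  have ge c : c \in N -> (pure_mon c <= edge_mon D a b)%MM ->
      mon_ideal (pure_mons N) ('X_[edge_mon D a b] : {mpoly K[n]}).
    move=> cN le; apply/mon_idealX; exists (pure_mon c) => //.
    by apply/pure_monsP; exists c.
  have [aN|aN] := boolP (adj D x a).
    apply: (ge a); first by rewrite inE aS'.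
    by rewrite /pure_mon (weight_tail hsink eab) mulm1n lem_addr.
  have [bN|bN] := boolP (adj D x b).
    by apply: (ge b); [rewrite inE bS' | exact: lem_addl].
  have := sim a b aS' bS' (edge_neq eab).
  rewrite /compl_graph eq_sym ax aN [x == b]eq_sym bx bN => /(_ isT isT).
  by rewrite /adj eab andbF.
- apply/min_mon_gensP; split=> //; first exact: ideal_mulX_mon.
  by move=> u v us vs; apply: aS; rewrite -mem mem_cat ?us ?vs.
- exact: edge_mons_min.
apply/min_mon_gensP; split; last by move=> u v; rewrite !mem; exact: aS.
  rewrite cat_uniq uxN uS' andbT /=; apply/hasPn => u.
  move=> /edge_monsP[a [b [_ + + ->]]]; rewrite !inE => /andP[ax _] /andP[bx _].
  apply/negP => /mapP[v _ /(congr1 (fun m : 'X_{1..n} => m x))].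
  by rewrite edge_monE (negPf ax) (negPf bx) mnmDE mnm1E eqxx.
by apply: mon_ideal_mem => m; rewrite mem.
Qed.

End EdgeIdealSplitting.

Local Close Scope ring_scope.

Theorem theorem4p2 (K : fieldType) (n : nat) (D : wograph n)
    (hsink : forall x, x \in Vplus D -> sink D x) :
  [<-> componentwise_linear (edge_ideal K D);
       vertex_splittable [set: 'I_n] (edge_ideal K D);
       linear_quotients (edge_ideal K D);
       chordal (compl_graph (adj D)) /\
         forall x : 'I_n, #|nbhd D x :&: Vplus D| <= 1].
Proof.
have VS_LQ : vertex_splittable [set: 'I_n] (edge_ideal K D) ->
  linear_quotients (edge_ideal K D) by exact: vertex_splittable_linear_quotients.
have LQ_CL : linear_quotients (edge_ideal K D) ->
  componentwise_linear (edge_ideal K D) by exact: linear_quotients_componentwise.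
have CL_4 : componentwise_linear (edge_ideal K D) ->
    chordal (compl_graph (adj D)) /\ forall x, #|nbhd D x :&: Vplus D| <= 1.
  move=> CL; split; first exact: componentwise_chordal CL.
  by move=> x; exact: componentwise_nbhd CL x.
have VS_4 : chordal (compl_graph (adj D)) /\ (forall x, #|nbhd D x :&: Vplus D| <= 1) ->
    vertex_splittable [set: 'I_n] (edge_ideal K D).
  move=> [ch nb]; refine (vertex_splittable_ext (ideal_eq_sym (@edge_ideal_mon _ D K)) _).
  exact: edge_mons_vertex_splittable.
tfae; [by move/CL_4/VS_4 | exact: VS_LQ | by move/LQ_CL/CL_4 | by move/VS_4/VS_LQ/LQ_CL].
Qed.
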